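(* Let $(X,\tau)$ be an uncountable Polish space and $1\le\xi<\omega_1$. The ranks $\alpha^*_\xi,\beta^*_\xi,\gamma^*_\xi$ are unbounded in $\omega_1$. Moreover, for every non-empty perfect set $P\subseteq X$ and every ordinal $\zeta<\omega_1$ there exists a set $A\subseteq P$ such that $\chi_A$ is of Baire class $\xi$ and $\alpha^*_\xi(\chi_A),\beta^*_\xi(\chi_A),\gamma^*_\xi(\chi_A)\ge\zeta$.
   Context: For a Baire class $\xi$ function $f$, let $T_{f,\xi}$ be the set of Polish topologies $\tau'\supseteq\tau$ on $X$ with $\tau'\subseteq\boldsymbol\Sigma^0_\xi(\tau)$ such that $f$ is Baire class $1$ with respect to $\tau'$. For a rank $\rho$ on Baire class $1$ functions, $\rho^*_\xi(f)=\min_{\tau'\in T_{f,\xi}}\rho_{\tau'}(f)$, where $\rho_{\tau'}$ is $\rho$ computed in topology $\tau'$. Base ranks (in a topology on $X$): derivatives are monotone maps $D$ on closed sets with $D(F)\subseteq F$; iterates $D^{\eta+1}=D\circ D^\eta$, intersections at limits; $\mathrm{rk}(D)$ = least $\eta$ with $D^\eta(X)=\emptyset$. $\alpha(f)=\sup_{p<q\in\mathbb{Q}}\mathrm{rk}(D_{A,B})$, $A=\{f\le p\}$, $B=\{f\ge q\}$, $D_{A,B}(F)=\overline{F\cap A}\cap\overline{F\cap B}$. $\beta(f)=\sup_{\varepsilon>0}\mathrm{rk}(D_{f,\varepsilon})$, $D_{f,\varepsilon}(F)=\{x\in F:\inf_{U\ni x\text{ open}}\sup_{x_1,x_2\in U\cap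 F}|f(x_1)-f(x_2)|\ge\varepsilon\}$. $\gamma(f)=\min\{\sup_{\varepsilon>0}\mathrm{rk}(D_{(f_n),\varepsilon}): f_n\text{ continuous}, f_n\to f\text{ pointwise}\}$, $D_{(f_n),\varepsilon}(F)=\{x\in F:\inf_{U\ni x\text{ open}}\inf_N\sup\{|f_m(y)-f_n(y)|:n,m\ge N,y\in U\cap F\}\ge\varepsilon\}$. A perfect set is a closed set without isolated points. *)

(* Defs.v *)
From HB Require Import structures.
From mathcomp Require Import all_boot all_order all_algebra.
From mathcomp Require Import wochoice.
From mathcomp Require Import all_classical all_reals all_analysis.

Set Implicit Arguments.
Unset Strict Implicit.
Unset Printing Implicit Defensive.

Import Order.TTheory GRing.Theory Num.Theory.
Import numFieldNormedType.Exports.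

Local Open Scope classical_set_scope.
Local Open Scope ring_scope.

(* Well-ordered sets of order type omega_1.  They are pairwise isomorphic, and
   the elements of any of them serve as the ordinals < omega_1. *)
HB.mixin Record isOmega1 d (W : Type) & Order.BTotal d W := {
  omega1_wf : well_founded (fun a b : W => (a < b)%O);
  omega1_uncountable : ~ countable [set: W];
  omega1_countable_lt : forall a : W, countable [set b : W | (b < a)%O] }.

#[short(type="omega1Type")]
HB.structure Definition Omega1 d := {W of Order.BTotal d W & isOmega1 d W}.

Lemma countableU T (A B : set T) : countable A -> countable B -> countable (A `|` B).
Proof.
move=> cA cB; have -> : A `|` B = \bigcup_(i in [set: bool]) (if i then A else B).
  by apply/seteqP; split=> [x [?|?]|x [[] _ /=]];
     [exists true|exists false|left|right].
by apply: bigcup_countable => // -[].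
Qed.

Lemma uncountable_subsets : ~ countable [set: set nat].
Proof.
move=> /countable_injP[f finj].
pose D : set nat := [set n | exists2 A, f A = n & ~ A n].
have nD : ~ D (f D).
  move=> /[dup] DD [A fA]; suff -> : A = D by [].
  by apply: finj fA; rewrite in_setT.
by apply: (nD); exists D.
Qed.

(* A witness of the structure: in a well-order on the subsets of N, the
   elements with countably many predecessors. *)
Section Omega1_witness.

Let r : rel (set nat) := sval (well_ordering_principle (set nat : eqType)).

Let r_min (A : set (set nat)) : A !=set0 ->
  exists2 m, A m & forall B, A B -> r m B.
Proof.
move=> [B AB]; have := svalP (well_ordering_principle (set nat : eqType)).
move=> /(_ [pred C | `[< A C >]]) [|m [[]]]; first by exists B; exact/asboolP.
move=> /asboolP Am mmin _; exists m => // C AC; apply: mmin; exact/asboolP.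
Qed.

Let r_chain : @wo_chain (set nat) r predT.
Proof. by move=> A _; exact: (svalP (well_ordering_principle _)). Qed.

Let r_total : total r. Proof. by move=> A B; exact: (wo_chainW r_chain). Qed.

Let r_refl : reflexive r.
Proof. by move=> A; exact: (wo_chain_reflexive r_chain). Qed.

Let r_anti : antisymmetric r.
Proof. by move=> A B; exact: (wo_chain_antisymmetric r_chain). Qed.

Let r_trans : transitive r.
Proof.
move=> B A C AB BC; have [|m] := @r_min [set D | D = A \/ D = B \/ D = C].
  by exists A; left.
move=> mABC mle; have mA : r m A by apply: mle; left.
case: mABC => [mE|[mE|mE]]; move: mle mA; rewrite mE => mle mA.
- by apply: mle; right; right.
- by have -> : A = B by apply: r_anti; rewrite AB.
- have <- : B = C; last exact: AB.
  by apply: r_anti; rewrite BC mle//; right; left.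
Qed.

Fact omega1_display : Order.disp_t. Proof. exact: (Order.Disp tt tt). Qed.

Definition omega1 : Type := {A : set nat | `[< countable [set B | r B A] >]}.

HB.instance Definition _ := [Choice of omega1 by <:].

Let le (a b : omega1) := r (val a) (val b).

Let le_refl : reflexive le. Proof. by move=> a; exact: r_refl. Qed.
Let le_anti : antisymmetric le. Proof. by move=> a b /r_anti/val_inj. Qed.
Let le_trans : transitive le. Proof. by move=> b a c; exact: r_trans. Qed.
Let le_total : total le. Proof. by move=> a b; exact: r_total. Qed.

Let le_min (A : set omega1) : A !=set0 -> exists2 m, A m & forall b, A b -> le m b.
Proof.
move=> [a Aa]; have [|_ [m Am <-] mmin] := @r_min (val @` A).
  by exists (val a), a.
by exists m => // b Ab; apply: mmin; exists b.
Qed.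

Let bot : {b : omega1 | forall a, le b a}.
Proof.
apply: cid; have [|m _ mmin] := @r_min setT; first by exists set0.
have mP : `[< countable [set B | r B m] >].
  apply/asboolP; apply: (@sub_countable _ _ _ [set m]); last exact: countable1.
  apply: subset_card_le => B /= Bm; apply: r_anti; rewrite Bm mmin//.
by exists (exist _ m mP) => a; exact: mmin.
Qed.

HB.instance Definition _ :=
  Order.Le_isPOrder.Build omega1_display omega1 le_refl le_anti le_trans.
HB.instance Definition _ :=
  Order.POrder_isTotal.Build omega1_display omega1 le_total.
HB.instance Definition _ :=
  Order.hasBottom.Build omega1_display omega1 (svalP bot).

Let omega1_wf : well_founded (fun a b : omega1 => (a < b)%O).
Proof.
move=> a; apply: contrapT => na.
have [|m nm mmin] := @le_min [set b | ~ Acc (fun a b : omega1 => (a < b)%O) b].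
  by exists a.
apply: nm; split=> b bm; apply: contrapT => /mmin mb.
by have := lt_le_trans bm (mb : (m <= b)%O); rewrite ltxx.
Qed.

Let omega1_countable_lt (a : omega1) : countable [set b : omega1 | (b < a)%O].
Proof.
have /asboolP/countable_injP[f finj] := valP a.
apply/countable_injP; exists (f \o val) => b c; rewrite !inE/= => ba ca.
have le_a c' : (c' < a)%O -> val c' \in [set B | r B (val a)].
  by move=> c'a; rewrite inE; exact: (ltW c'a : (c' <= a)%O).
by move=> /finj fbc; apply/val_inj/fbc; exact: le_a.
Qed.

Let omega1_uncountable : ~ countable [set: omega1].
Proof.
move=> cW; apply: uncountable_subsets.
pose Q := [set A | countable [set B | r B A]].
have cQ : countable Q.
  have /countable_injP[f finj] := cW.
  pose g A := if pselect (Q A) is left h then f (exist _ A (asboolT h)) else 0%N.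
  apply/countable_injP; exists g => A B; rewrite !inE /g => QA QB.
  case: pselect => // hA; case: pselect => // hB /finj; rewrite !in_setT.
  by move=> /(_ isT isT) /(congr1 val).
suff <- : Q = setT by [].
rewrite -subTset => A _; apply: contrapT => nQ.
have [|m nQm mmin] := @r_min (~` Q); first by exists A.
apply: nQm; apply: (@sub_countable _ _ _ (m |` Q)).
  apply: subset_card_le => B /= Bm; have [?|/mmin mB] := pselect (Q B); first by right.
  by left; apply: r_anti; rewrite Bm.
by apply: countableU => //; exact: countable1.
Qed.

HB.instance Definition _ := isOmega1.Build omega1_display omega1
  omega1_wf omega1_uncountable omega1_countable_lt.

End Omega1_witness.

Section Ordinals.
Context {d : Order.disp_t} {W : omega1Type d}.
Implicit Types (a b : W) (A : set W) (S : set (option W)).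

Definition least A a := A a /\ forall b, A b -> (a <= b)%O.

Definition is_succ a b := least [set c | (a < c)%O] b.

Definition osucc a : W := xget a [set b | is_succ a b].

Lemma least_ex A : A !=set0 -> exists a, least A a.
Proof.
move=> [a Aa]; elim/(well_founded_ind (@omega1_wf d W)): a Aa => a IH Aa.
have [[b [Ab ba]]|na] := pselect (exists b, A b /\ (b < a)%O); first exact: IH ba Ab.
by exists a; split=> // b Ab; rewrite leNgt; apply/negP => ba; apply: na; exists b.
Qed.

Lemma osuccP a : is_succ a (osucc a).
Proof.
apply: xgetPex; apply: least_ex; apply: contrapT => na.
apply: (@omega1_uncountable d W).
have aT : [set: W] `<=` a |` [set b | (b < a)%O].
  move=> b _; have [ab|ba|->] := ltgtP a b; [|by right|by left].
  by case: na; exists b.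
apply: (sub_countable (subset_card_le aT)).
by apply: countableU; [exact: countable1|exact: omega1_countable_lt].
Qed.

Lemma is_succ_inj a b c : is_succ a c -> is_succ b c -> a = b.
Proof.
move=> [/= ac cmin] [/= bc cmin']; apply/eqP; rewrite eq_le !leNgt.
apply/andP; split; apply/negP => h.
  by have := cmin' _ h; rewrite leNgt ac.
by have := cmin _ h; rewrite leNgt bc.
Qed.

Definition oone : W := osucc \bot%O.

(* Values of ranks lie in [option W], where [None] is a top element meaning
   that there is no value below omega_1. *)

Definition omin A : option W := xget None [set Some a | a in [set a | least A a]].

Definition le_opt (r s : option W) : bool :=
  match r, s with
  | _, None => true
  | None, Some _ => false
  | Some a, Some b => (a <= b)%O
  end.

Definition min_rank S : option W := omin [set a | S (Some a)].

Definition sup_rank S : option W :=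
  omin [set a | forall r, S r -> le_opt r (Some a)].

(* Ranks are omega_1-valued, so a bound from below also asserts that the rank
   is not the formal value [None]. *)
Definition countable_ge (zeta : W) (r : option W) : bool :=
  if r is Some a then (zeta <= a)%O else false.

Context {T : Type}.
Implicit Types D : set T -> set T.

Definition iter_step D a (rec : forall b, (b < a)%O -> set T) : set T :=
  match pselect (exists2 b, (b < a)%O & is_succ b a) with
  | left h => let: exist2 b ba _ := cid2 h in D (rec b ba)
  | right _ => [set x | forall b (ba : (b < a)%O), rec b ba x]
  end.

(* D^a(T); the limit clause also covers D^0(T) = T *)
Definition iter_der D : W -> set T :=
  Fix omega1_wf (fun=> set T) (iter_step D).

Lemma iter_derE D a : iter_der D a = iter_step D (fun b (_ : (b < a)%O) => iter_der D b).
Proof.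
rewrite /iter_der Fix_eq// => b r s rs; suff -> : r = s by [].
by apply: functional_extensionality_dep => c; apply/funext => cb; exact: rs.
Qed.

Lemma iter_derS D a : iter_der D (osucc a) = D (iter_der D a).
Proof.
rewrite iter_derE /iter_step; case: pselect => [h|[]]; last first.
  by exists a; [case: (osuccP a)|exact: osuccP].
by case: cid2 => b _ /is_succ_inj /(_ (osuccP a)) ->.
Qed.

Lemma iter_der_lim D a : (forall b, a <> osucc b) ->
  iter_der D a = \bigcap_(b in [set b | (b < a)%O]) iter_der D b.
Proof.
move=> lim; rewrite iter_derE /iter_step; case: pselect => // h.
exfalso; case: h => b ba [_ h]; apply: (lim b).
have [bS Smin] := osuccP b.
by apply/eqP; rewrite eq_le (h _ bS) (Smin _ ba).
Qed.

Lemma iter_der0 D : iter_der D \bot%O = setT.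
Proof.
rewrite iter_der_lim => [|b b0].
  by rewrite -subTset => x _ b /=; rewrite ltx0.
by have [] := osuccP b; rewrite /= -b0 ltx0.
Qed.

Definition rk D : option W := omin [set a | iter_der D a = set0].

End Ordinals.

Section Hierarchies.
Context {d : Order.disp_t} {W : omega1Type d} {R : realType}.
Context {X : topologicalType}.

Inductive baire_class : W -> (X -> R) -> Prop :=
| baire_class0 f : continuous f -> baire_class \bot%O f
| baire_class_lim xi f (eta : nat -> W) (g : nat -> X -> R) :
    (forall n, (eta n < xi)%O) -> (forall n, baire_class (eta n) (g n)) ->
    (forall x, g n x @[n --> \oo] --> f x) -> baire_class xi f.

Inductive Sigma0 : W -> set X -> Prop :=
| Sigma0_open A : open A -> Sigma0 oone A
| Sigma0_bigcup xi (eta : nat -> W) (A : nat -> set X) :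
    (forall n, (oone <= eta n)%O) -> (forall n, (eta n < xi)%O) ->
    (forall n, Sigma0 (eta n) (~` A n)) -> Sigma0 xi (\bigcup_n A n).

End Hierarchies.

Definition polish (R : realType) (X : topologicalType) : Prop :=
  (exists2 D : set X, countable D & dense D) /\
  exists M : Metric R X, let MX : metricType R := Metric.Pack M in
    @open MX = @open X /\
    forall u : nat -> MX, cauchy (u @ \oo) -> exists l : MX, u @ \oo --> l.

Section Ranks.
Context {d : Order.disp_t} {W : omega1Type d} {R : realType}.
Context {X : topologicalType}.
Implicit Types (f : X -> R) (F A B : set X).

Definition der_sep A B F : set X := closure (F `&` A) `&` closure (F `&` B).

Definition alpha f : option W :=
  sup_rank [set rk (der_sep [set x | f x <= ratr pq.1] [set x | f x >= ratr pq.2])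
           | pq in [set pq : rat * rat | pq.1 < pq.2]].

Definition der_osc f (e : R) F : set X :=
  [set x | F x /\
    (e%:E <= ereal_inf
      [set ereal_sup [set `|f y.1 - f y.2|%:E | y in (U `&` F) `*` (U `&` F)]
      | U in open_nbhs x])%E].

Definition beta f : option W :=
  sup_rank [set rk (der_osc f e) | e in [set e : R | 0 < e]].

Definition der_seq (g : nat -> X -> R) (e : R) F : set X :=
  [set x | F x /\
    (e%:E <= ereal_inf
      [set ereal_inf
        [set ereal_sup [set r | exists m n y,
            [/\ (N <= m)%N, (N <= n)%N, (U `&` F) y & r = `|g m y - g n y|%:E]]
        | N in [set: nat]]
      | U in open_nbhs x])%E].

Definition gamma f : option W :=
  min_rank [set sup_rank [set rk (der_seq g e) | e in [set e : R | 0 < e]]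
           | g in [set g : nat -> X -> R |
               (forall n, continuous (g n)) /\
               (forall x, g n x @[n --> \oo] --> f x)]].

End Ranks.

Section Modification.
Context {d : Order.disp_t} {W : omega1Type d} {R : realType}.
Context {X : topologicalType}.
Implicit Types (xi : W) (f : X -> R).

(* T_{f,xi}.  A topology on X is encoded as a [Topological] structure on the
   carrier of X. *)
Definition refinements f xi : set (Topological X) :=
  [set t | let Xt : topologicalType := Topological.Pack t in
    [/\ polish R Xt, @open X `<=` @open Xt,
        @open Xt `<=` @Sigma0 d W X xi & @baire_class d W R Xt oone f]].

Definition rank_star (rho : forall Y : topologicalType, (Y -> R) -> option W)
    xi f : option W :=
  min_rank [set rho (Topological.Pack t) f | t in refinements f xi].

Definition alpha_star := rank_star (@alpha d W R).
Definition beta_star := rank_star (@beta d W R).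
Definition gamma_star := rank_star (@gamma d W R).

Definition unbounded_in_omega1 (rho : W -> (X -> R) -> option W) xi : Prop :=
  forall zeta : W, exists2 f, baire_class xi f & countable_ge zeta (rho xi f).

End Modification.

(* Main.v *)
(* A set of rank below [zeta] in a refined topology is a transfinite difference, of
   length below [zeta], of closed sets of that topology, hence of Pi^0_xi sets of
   the original one.  Diagonalizing over a Cantor set in [P] against a universal
   Sigma^0_xi set yields a set [A] that is no such difference.  By construction
   [A] is the set of points for which the first satisfied one of countably many
   well-ordered Sigma^0_xi conditions is labelled true; it is a limit of
   finite-stage approximations, so its indicator has Baire class [xi], and Baire
   class 1 once the conditions are open.  A Polish refinement that makes them open
   exists because adding to the metric countably many coordinates with a closed
   graph preserves completeness.  Finally alpha <= beta <= gamma, and gamma is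
   countable by the Baire category argument. *)
Require Import Defs.
From HB Require Import structures.
From mathcomp Require Import all_boot all_order all_algebra.
From mathcomp Require Import all_classical all_reals all_analysis.
From mathcomp Require Import lra.

Set Implicit Arguments.
Unset Strict Implicit.
Unset Printing Implicit Defensive.

Import Order.TTheory GRing.Theory Num.Theory.
Import numFieldNormedType.Exports.

Local Open Scope classical_set_scope.
Local Open Scope ring_scope.

(** * Polish metrics *)

(** The minimum in the starred ranks runs over all refinements at once, and refinements cannot be
    enumerated by points of the space. All that is retained of a refinement is that its closed sets
    are Pi^0_xi for the original topology. It therefore suffices to defeat every pair of families
    [F], [G] of Pi^0_xi sets indexed by the ordinals below [zeta], whether or not they come from a
    derivative. Since [zeta] is countable, one point of the Cantor set codes such a pair column by
    column, and at the point coding it the set receives the value opposite to the one predicted. The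
    opposite value is again read off from the first exit from the families, so the diagonal set has
    the same shape as the sets it defeats.

    Every condition contains the complement of the Cantor set: relatively open subsets of the Cantor
    set thereby become open in the whole space, which matters when [xi] is 1.

    A lower bound alone is not enough, because [countable_ge] also asserts that the value exists.
    One refinement with a countable gamma must be exhibited; the alpha and beta values then exist as
    well. *)

Record polish_dist (R : realType) (X : topologicalType) (m : X -> X -> R) : Prop :=
  PolishDist {
  pd_refl : forall x, m x x = 0;
  pd_eq : forall x y, m x y = 0 -> x = y;
  pd_sym : forall x y, m x y = m y x;
  pd_tri : forall y x z, m x z <= m x y + m y z;
  pd_open : forall U : set X,
    open U <-> forall x, U x -> exists2 r : R, 0 < r & forall y, m x y < r -> U y;
  pd_complete : forall u : nat -> X,
    (forall e : R, 0 < e ->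
       exists N, forall i j, (N <= i)%N -> (N <= j)%N -> m (u i) (u j) < e) ->
    exists l, forall e : R, 0 < e -> \forall n \near \oo, m l (u n) < e;
  pd_sep : exists s : nat -> option X,
    forall x (e : R), 0 < e -> exists n y, s n = Some y /\ m x y < e }.

Section PolishDist.
Context {R : realType} {X : topologicalType} {m : X -> X -> R}.
Hypothesis mP : polish_dist m.

Lemma pd_ge0 x y : 0 <= m x y.
Proof.
by have := pd_tri mP y x x; rewrite (pd_refl mP) (pd_sym mP y x); lra.
Qed.

Lemma pd_ball_open x r : open [set y | m x y < r].
Proof.
apply/(pd_open mP) => y /= xy; exists (r - m x y); first by rewrite subr_gt0.
by move=> z yz; rewrite /=; have := pd_tri mP y x z; lra.
Qed.

Lemma pd_nbhs x (A : set X) :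
  nbhs x A <-> exists2 r : R, 0 < r & forall y, m x y < r -> A y.
Proof.
split=> [|[r r0 rA]].
  rewrite nbhsE => -[U [oU Ux] UA].
  have [r r0 rU] := (pd_open mP U).1 oU x Ux.
  by exists r => // y /rU/UA.
rewrite nbhsE; exists [set y | m x y < r] => //; split; first exact: pd_ball_open.
by rewrite /= (pd_refl mP).
Qed.

Lemma pd_cvg (u : nat -> X) x :
  (u n @[n --> \oo] --> x) <-> forall e : R, 0 < e -> \forall n \near \oo, m x (u n) < e.
Proof.
split=> [ux e e0|ux A /pd_nbhs[r r0 rA]].
  by apply: (ux [set y | m x y < e]); apply/pd_nbhs; exists e.
by apply: filterS (ux _ r0) => n /rA.
Qed.

Lemma pd_closure (A : set X) x :
  closure A x <-> forall e : R, 0 < e -> exists2 y, A y & m x y < e.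
Proof.
split=> [Ax e e0|Ae B /pd_nbhs[r r0 rB]].
  have [|y [Ay]] := Ax [set y | m x y < e]; first by apply/pd_nbhs; exists e.
  by exists y.
by have [y Ay /rB By] := Ae r r0; exists y.
Qed.

Lemma pd_closed_cvg (F : set X) (u : nat -> X) x :
  closed F -> (\forall n \near \oo, F (u n)) -> u n @[n --> \oo] --> x -> F x.
Proof. by move=> cF Fu ux; exact: (@closed_cvg _ _ \oo _ u F cF Fu _ ux). Qed.

Lemma pd_closed_ball x r : closed [set y | m x y <= r].
Proof.
rewrite -[X in closed X]setCK; apply: open_closedC.
apply/(pd_open mP) => y /=; move/negP; rewrite -ltNge => ry.
exists (m x y - r); first by rewrite subr_gt0.
move=> z yz; apply/negP; rewrite -ltNge.
by have := pd_tri mP z x y; rewrite (pd_sym mP z y); lra.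
Qed.

(** Cantor's intersection argument, shared by the Baire category proof and the Cantor scheme. The
    balls are closed so that the limit of the centers stays in all of them. *)
Lemma pd_nested (x : nat -> X) (r : nat -> R) :
  (forall k y, m (x k.+1) y <= r k.+1 -> m (x k) y <= r k) ->
  (forall e : R, 0 < e -> exists k, r k < e) -> (forall k, 0 <= r k) ->
  exists2 l, forall k, m (x k) l <= r k & x n @[n --> \oo] --> l.
Proof.
move=> sub r0 rge0.
have nest k i : m (x k) (x (k + i)%N) <= r k.
  have h j : forall y, m (x (k + j)%N) y <= r (k + j)%N -> m (x k) y <= r k.
    elim: j => [|j IH] y; first by rewrite addn0.
    by rewrite addnS => /sub/IH.
  by apply: (h i); rewrite (pd_refl mP).
have [|l xl] := pd_complete mP (u := x).
  move=> e e0; have [k rk] := r0 (e / 2) (divr_gt0 e0 (ltr0n _ 2)).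
  exists k => i j ki kj.
  have := nest k (i - k)%N; have := nest k (j - k)%N; rewrite !subnKC//.
  by have := pd_tri mP (x k) (x i) (x j); rewrite (pd_sym mP (x i) (x k)); lra.
have {}xl : x n @[n --> \oo] --> l by apply/pd_cvg.
exists l => // k.
suff : [set y | m (x k) y <= r k] l by [].
apply: (pd_closed_cvg (@pd_closed_ball (x k) (r k)) _ xl).
by exists k => // n /= kn; rewrite -(subnKC kn).
Qed.

Lemma pd_base : exists B : nat -> set X, (forall n, open (B n)) /\
  forall x U, open U -> U x -> exists n, B n x /\ B n `<=` U.
Proof.
have [s sd] := pd_sep mP.
pose B n : set X := if unpickle n is Some (i, k) then
  (if s i is Some z then [set y | m z y < k.+1%:R^-1] else set0) else set0.
exists B; split=> [n|x U oU Ux].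
  rewrite /B; case: unpickle => [[i k]|]; last exact: open0.
  by case: (s i) => [z|]; [exact: pd_ball_open|exact: open0].
have [r r0 rU] := (pd_open mP U).1 oU x Ux.
have [k /= _ /(_ k (leqnn k)) kr] := near_infty_natSinv_lt (PosNum (divr_gt0 r0 (ltr0n R 2))).
rewrite /= in kr.
have k0 : 0 < k.+1%:R^-1 :> R by rewrite invr_gt0 ltr0n.
have [n [z [nz xz]]] := sd x _ k0.
exists (pickle (n, k)); rewrite /B pickleK nz; split; first by rewrite /= (pd_sym mP).
by move=> y /=; move: kr xz; set c := _^-1 => kr xz zy; apply: rU; have := pd_tri mP z x y; lra.
Qed.

End PolishDist.

(** Several topologies on one carrier are compared below, so the metric is carried as a bare
    function; this is the bridge to the bundled structure in [polish]. The [option] in [pd_sep]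
    allows for an empty space. *)
Lemma polish_distP (R : realType) (X : topologicalType) :
  polish R X <-> exists m : X -> X -> R, polish_dist m.
Proof.
split=> [[[D cD dD] [M [oM cM]]]|[m mP]]; last first.
  split.
    have [s sd] := pd_sep mP.
    exists (\bigcup_n [set y | s n = Some y]).
      apply: bigcup_countable => // n _; apply: finite_set_countable.
      case: (s n) => [y|].
        by apply: (sub_finite_set _ (finite_set1 y)) => z [->].
      by apply: (sub_finite_set _ (finite_set0 _)) => z.
    move=> U [x Ux] /(pd_open mP) oU; have [r r0 rU] := oU x Ux.
    have [n [y [ny xy]]] := sd x r r0.
    by exists y; split; [exact: rU|exists n].
  pose MB := @isMetric.Build R X m (pd_refl mP) (pd_eq mP) (pd_sym mP) (pd_tri mP).
  pose MT : metricType R := HB.pack (X : Type) (Choice.class X) MB.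
  have dE : @mdist R MT = m by [].
  exists (Metric.class MT); split.
    apply/seteqP; split=> U.
      move=> oU; apply/(pd_open mP) => x Ux.
      have : @nbhs MT MT x U by exact: open_nbhs_nbhs.
      by rewrite -(@metricType_numDomainType.filter_from_mdist_nbhs R MT) => -[r r0 rU]; exists r.
    move=> /(pd_open mP) oU; rewrite openE => x Ux; rewrite /interior.
    suff : @nbhs MT MT x U by [].
    rewrite -(@metricType_numDomainType.filter_from_mdist_nbhs R MT).
    by have [r r0 rU] := oU x Ux; exists r.
  move=> u /(@cauchy_ballP R MT) cu.
  have [|l ul] := pd_complete mP (u := u).
    move=> e e0; have [[A B] [[N _ NA] [M _ MB']] AB] := cu e e0.
    exists (maxn N M) => i j; rewrite !geq_max => /andP[Ni Mi] /andP[Nj Mj].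
    have := AB (u i, u j); rewrite ballEmdist; apply; split.
      exact: NA.
    exact: MB'.
  exists l; apply/(@metricType_numDomainType.cvgrPdist_lt R MT) => e e0.
  exact: ul.
pose MT : metricType R := Metric.Pack M.
have nbE (x : X) : @nbhs MT MT x = @nbhs X X x.
  rewrite !nbhsE; apply/funext => A; apply/propext.
  by split=> -[U [oU Ux] UA]; exists U => //; split=> //; move: oU; rewrite ?oM -?oM.
exists (@mdist R MT); split.
- by move=> x; exact: (@mdistxx R MT).
- by move=> x y; exact: (@mdist_positivity R MT).
- by move=> x y; exact: (@metric_sym R MT).
- by move=> y x z; exact: (@metric_triangle R MT).
- move=> U; split=> [oU x Ux|oU].
    have : @nbhs X X x U by exact: open_nbhs_nbhs.
    rewrite -nbE -(@metricType_numDomainType.filter_from_mdist_nbhs R MT).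
    by move=> [r r0 rU]; exists r.
  rewrite openE => x Ux; rewrite /interior -nbE.
  rewrite -(@metricType_numDomainType.filter_from_mdist_nbhs R MT).
  by have [r r0 rU] := oU x Ux; exists r.
- move=> u cu; have [|l ul] := cM u.
    apply/(@cauchy_ballP R MT) => e e0; have [N Nu] := cu e e0.
    exists ([set u n | n in [set n | (N <= n)%N]], [set u n | n in [set n | (N <= n)%N]]).
      by split; exists N => // n /= Nn; exists n.
    by move=> [_ _] [[i Ni <-] [j Nj <-]]; rewrite ballEmdist; exact: Nu.
  exists l => e e0.
  by have /(@metricType_numDomainType.cvgrPdist_lt R MT) := ul; exact.
- have /countable_injP[f finj] := cD.
  exists (fun n => if pselect (exists2 y, D y & f y = n) is left h
                   then Some (projT1 (cid2 h)) else None).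
  move=> x e e0.
  have [||y []] := dD [set y | @mdist R MT x y < e].
    by exists x; rewrite /= (@mdistxx R MT).
    rewrite -oM openE => y /= xy; rewrite /interior.
    rewrite -(@metricType_numDomainType.filter_from_mdist_nbhs R MT).
    exists (e - @mdist R MT x y); rewrite /= ?subr_gt0// => z /= yz.
    by have := @metric_triangle R MT x y z; rewrite /=; lra.
  move=> /= xy Dy; exists (f y), y; split=> //; case: pselect => [h|[]]; last by exists y.
  by case: cid2 => z Dz /= /finj -> //; rewrite inE.
Qed.

(** * Borel and Baire classes *)

Section Omega1Lemmas.
Context {d : Order.disp_t} {W : omega1Type d}.
Implicit Types a b c : W.

Lemma lt_osucc a : (a < osucc a)%O.
Proof. by have [] := osuccP a. Qed.

Lemma osucc_le a b : (a < b)%O -> (osucc a <= b)%O.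
Proof. by have [_ h] := osuccP a => /h. Qed.

Lemma ltS_le a b : (a < osucc b)%O -> (a <= b)%O.
Proof. by rewrite !leNgt => aSb; apply/negP => /osucc_le; rewrite leNgt aSb. Qed.

Lemma lt0_oone : (\bot < oone :> W)%O.
Proof. exact: lt_osucc. Qed.

Lemma lt_oone a : (a < oone)%O -> a = \bot%O.
Proof. by move=> /ltS_le; rewrite lex0 => /eqP. Qed.

(** Otherwise the countable initial segments below the [s n] would cover [W]. *)
Lemma omega1_sup (s : nat -> W) : exists b, forall n, (s n <= b)%O.
Proof.
apply: contrapT => nb; apply: (@omega1_uncountable d W).
have sT : [set: W] `<=` \bigcup_n [set b | (b < s n)%O].
  move=> b _; apply: contrapT => bs; apply: nb; exists b => n.
  by rewrite leNgt; apply/negP => h; apply: bs; exists n.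
apply: (sub_countable (subset_card_le sT)).
by apply: bigcup_countable => // n _; exact: omega1_countable_lt.
Qed.

End Omega1Lemmas.

Definition nat_pair (p : nat) : nat * nat := odflt (0%N, 0%N) (unpickle p).

Lemma nat_pairK i j : nat_pair (pickle (i, j)) = (i, j).
Proof. by rewrite /nat_pair pickleK. Qed.

Section Sigma0Lemmas.
Context {d : Order.disp_t} {W : omega1Type d} {R : realType} {X : topologicalType}.
Context {m : X -> X -> R}.
Hypothesis mP : polish_dist m.
Implicit Types (xi : W) (S : set X).

Lemma Sigma0_inv xi S : Sigma0 xi S -> (xi = oone /\ open S) \/
  exists eta A, [/\ forall n : nat, (oone <= eta n)%O, forall n, (eta n < xi)%O,
    forall n, Sigma0 (eta n) (~` A n) & S = \bigcup_n A n].
Proof.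
case=> [A oA|{}xi eta A e1 exi sA]; first by left.
by right; exists eta, A.
Qed.

Lemma Sigma0_ge1 xi S : Sigma0 xi S -> (oone <= xi)%O.
Proof.
move=> /Sigma0_inv[[-> //]|[eta [A [e1 exi _ _]]]].
exact: le_trans (e1 0%N) (ltW (exi 0%N)).
Qed.

Lemma Sigma0_open_inv S : Sigma0 (oone : W) S -> open S.
Proof.
move=> /Sigma0_inv[[]//|[eta [A [e1 exi _ _]]]].
by have := e1 0%N; rewrite leNgt exi.
Qed.

(** The pieces consist of the points whose ball of radius 1/(n+1) lies in [S]. A union in [Sigma0]
    is built from strictly lower classes, so this is what carries open sets into the higher classes
    in [Sigma0_le]. *)
Lemma open_Fsigma S : open S ->
  exists A : nat -> set X, (forall n, open (~` A n)) /\ S = \bigcup_n A n.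
Proof.
move=> oS; exists (fun n => [set x | forall y, m x y < n.+1%:R^-1 -> S y]).
split=> [n|].
  rewrite openE => x /= /existsNP[y /not_implyP[xy nSy]].
  apply/(pd_nbhs mP); exists (n.+1%:R^-1 - m x y); first by rewrite subr_gt0.
  move=> z xz /(_ y) h; apply: nSy; apply: h; move: xz xy; set c := _^-1 => xz xy.
  by have := pd_tri mP x z y; rewrite (pd_sym mP z x); lra.
apply/seteqP; split=> [x Sx|x [n _ /(_ x)]].
  have [r r0 rS] := (pd_open mP S).1 oS x Sx.
  have [k /= _ /(_ k (leqnn k)) kr] := near_infty_natSinv_lt (PosNum r0).
  by exists k => // y xy; apply: rS; exact: lt_trans xy kr.
by rewrite (pd_refl mP) => h; apply: h; rewrite invr_gt0.
Qed.

Lemma Sigma0_normal xi S : (oone < xi)%O -> Sigma0 xi S ->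
  exists eta A, [/\ forall n : nat, (oone <= eta n)%O, forall n, (eta n < xi)%O,
    forall n, Sigma0 (eta n) (~` A n) & S = \bigcup_n A n].
Proof. by move=> xi1 /Sigma0_inv[[E]|//]; rewrite E ltxx in xi1. Qed.

Lemma Sigma0_le xi xi' S : (xi <= xi')%O -> Sigma0 xi S -> Sigma0 xi' S.
Proof.
rewrite le_eqVlt => /orP[/eqP ->//|lt] /Sigma0_inv[[E oS]|].
  rewrite E in lt; have [A [oA ->]] := open_Fsigma oS.
  by apply: (Sigma0_bigcup (eta := fun=> oone)) => // n; exact: Sigma0_open.
move=> [eta [A [e1 e2 sA ->]]].
by apply: (Sigma0_bigcup e1) => // n; exact: lt_trans (e2 n) lt.
Qed.

Lemma Sigma0_compl xi xi' S : (xi < xi')%O -> Sigma0 xi S -> Sigma0 xi' (~` S).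
Proof.
move=> lt SS; have -> : ~` S = \bigcup_(n in [set: nat]) ~` S.
  by apply/seteqP; split=> [x Sx|x []//]; exists 0%N.
apply: (Sigma0_bigcup (eta := fun=> xi)) => // _; first exact: Sigma0_ge1 SS.
by rewrite setCK.
Qed.

Lemma Sigma0_openS xi S : (oone <= xi)%O -> open S -> Sigma0 xi S.
Proof. by move=> /Sigma0_le h oS; apply: h; exact: Sigma0_open. Qed.

Lemma Sigma0_bigcupS xi (S : nat -> set X) :
  (forall n, Sigma0 xi (S n)) -> Sigma0 xi (\bigcup_n S n).
Proof.
move=> SS; have := Sigma0_ge1 (SS 0%N); rewrite le_eqVlt => /orP[/eqP E|xi1].
  rewrite -E; apply: Sigma0_open; apply: bigcup_open => n _.
  by apply: Sigma0_open_inv; rewrite E.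
have /choice[eta /choice[A h]] := fun n => Sigma0_normal xi1 (SS n).
have -> : \bigcup_n S n = \bigcup_p A (nat_pair p).1 (nat_pair p).2.
  apply/seteqP; split=> x.
    move=> [n _]; have [_ _ _ ->] := h n; move=> [k _ Ax].
    by exists (pickle (n, k)) => //; rewrite nat_pairK.
  move=> [p _ Ax]; exists (nat_pair p).1 => //.
  by have [_ _ _ ->] := h (nat_pair p).1; exists (nat_pair p).2.
apply: (Sigma0_bigcup (eta := fun p => eta (nat_pair p).1 (nat_pair p).2)) => p;
  by have [] := h (nat_pair p).1.
Qed.

Lemma Sigma0U xi S S' : Sigma0 xi S -> Sigma0 xi S' -> Sigma0 xi (S `|` S').
Proof.
move=> SS SS'.
have -> : S `|` S' = \bigcup_n (if n is 0%N then S else S').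
  apply/seteqP; split=> [x [Sx|Sx]|x [[|n] _ Sx]].
  - by exists 0%N.
  - by exists 1%N.
  - by left.
  - by right.
by apply: Sigma0_bigcupS => -[|n].
Qed.

Lemma Sigma0I xi S S' : Sigma0 xi S -> Sigma0 xi S' -> Sigma0 xi (S `&` S').
Proof.
move=> SS SS'; have := Sigma0_ge1 SS; rewrite le_eqVlt => /orP[/eqP E|xi1].
  by rewrite -E; apply: Sigma0_open; apply: openI; apply: Sigma0_open_inv; rewrite E.
have [eta [A [e1 e2 sA ->]]] := Sigma0_normal xi1 SS.
have [eta' [A' [e1' e2' sA' ->]]] := Sigma0_normal xi1 SS'.
have -> : \bigcup_n A n `&` \bigcup_n A' n =
    \bigcup_p (A (nat_pair p).1 `&` A' (nat_pair p).2).
  apply/seteqP; split=> x.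
    move=> [[n _ Ax] [k _ Ax']].
    by exists (pickle (n, k)) => //; rewrite nat_pairK.
  by move=> [p _ [Ax Ax']]; split; [exists (nat_pair p).1|exists (nat_pair p).2].
apply: (Sigma0_bigcup (eta := fun p => Order.max (eta (nat_pair p).1) (eta' (nat_pair p).2))).
- by move=> p; rewrite le_max e1.
- by move=> p; rewrite gt_max e2 e2'.
- move=> p; rewrite setCI; apply: Sigma0U.
    by apply: Sigma0_le (sA _); rewrite le_max lexx.
  by apply: Sigma0_le (sA' _); rewrite le_max lexx orbT.
Qed.

End Sigma0Lemmas.

Section BaireLemmas.
Context {d : Order.disp_t} {W : omega1Type d} {R : realType} {X : topologicalType}.
Implicit Types (xi : W) (f : X -> R).

Lemma baire_inv xi f : baire_class xi f -> (xi = \bot%O /\ continuous f) \/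
  exists eta g, [/\ forall n : nat, (eta n < xi)%O,
    forall n, baire_class (eta n) (g n) & forall x, g n x @[n --> \oo] --> f x].
Proof.
case=> [g cg|{}xi g eta h e1 e2 e3]; first by left.
by right; exists eta, h.
Qed.

Lemma baire0_inv f : baire_class (\bot%O : W) f -> continuous f.
Proof. by move=> /baire_inv[[]//|[eta [g [/(_ 0%N)]]]]; rewrite ltx0. Qed.

Lemma baire_normal xi f : (\bot < xi)%O -> baire_class xi f ->
  exists eta g, [/\ forall n : nat, (eta n < xi)%O,
    forall n, baire_class (eta n) (g n) & forall x, g n x @[n --> \oo] --> f x].
Proof.
move=> xi0 /baire_inv[[_ cf]|//]; exists (fun=> \bot%O), (fun=> f).
by split=> // [n|x]; [exact: baire_class0|exact: cvg_cst].
Qed.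

Lemma baire_le xi xi' f : (xi <= xi')%O -> baire_class xi f -> baire_class xi' f.
Proof.
rewrite le_eqVlt => /orP[/eqP ->//|lt] bf.
apply: (baire_class_lim (eta := fun=> xi) (g := fun=> f)) => // x.
exact: cvg_cst.
Qed.

(** Continuity of [op] is stated for arbitrary filters: the base case needs neighbourhood filters,
    the limit case the filter of sequences. *)
Lemma baire_op2 (op : R -> R -> R) :
  (forall (T : Type) (F : set_system T) (FF : Filter F) (u v : T -> R) (a b : R),
    u x @[x --> F] --> a -> v x @[x --> F] --> b ->
    op (u x) (v x) @[x --> F] --> op a b) ->
  forall xi f g, baire_class xi f -> baire_class xi g ->
    baire_class xi (fun x => op (f x) (g x)).
Proof.
move=> opc xi; elim/(well_founded_ind (@omega1_wf d W)): xi => xi IH f g bf bg.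
have [xi0|] := ltP \bot%O xi; last first.
  rewrite lex0 => /eqP E; rewrite E in bf bg *; apply: baire_class0 => x.
  by apply: opc; apply: baire0_inv.
have [eta [u [e1 e2 e3]]] := baire_normal xi0 bf.
have [eta' [v [e1' e2' e3']]] := baire_normal xi0 bg.
apply: (baire_class_lim (eta := fun n => Order.max (eta n) (eta' n))
  (g := fun n x => op (u n x) (v n x))) => [n|n|x].
- by rewrite gt_max e1 e1'.
- apply: IH; first by rewrite gt_max e1 e1'.
    by apply: baire_le (e2 n); rewrite le_max lexx.
  by apply: baire_le (e2' n); rewrite le_max lexx orbT.
- by apply: opc.
Qed.

Lemma baireD xi f g : baire_class xi f -> baire_class xi g ->
  baire_class xi (fun x => f x + g x).
Proof. by apply: (baire_op2 (op := +%R)) => T F FF u v a b; exact: cvgD. Qed.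

Lemma baireM xi f g : baire_class xi f -> baire_class xi g ->
  baire_class xi (fun x => f x * g x).
Proof. by apply: (baire_op2 (op := *%R)) => T F FF u v a b; exact: cvgM. Qed.

Lemma baire_cst xi (c : R) : baire_class xi (fun _ : X => c).
Proof.
by apply: (@baire_le \bot%O); [exact: le0x|apply: baire_class0 => x; exact: cvg_cst].
Qed.

Lemma baire_1B xi f : baire_class xi f -> baire_class xi (fun x => 1 - f x).
Proof.
move=> bf; apply: baireD; first exact: baire_cst.
have -> : (fun x => - f x) = (fun x => -1 * f x) by apply/funext => x; rewrite mulN1r.
by apply: baireM => //; exact: baire_cst.
Qed.

Lemma baire_sum xi (n : nat) (P : pred nat) (f : nat -> X -> R) :
  (forall k, (k < n)%N -> baire_class xi (f k)) ->
  baire_class xi (fun x => \sum_(k < n | P k) f k x).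
Proof.
elim: n => [|n IH] bf.
  by under eq_fun do rewrite big_ord0; exact: baire_cst.
under eq_fun do rewrite big_mkcond big_ord_recr /= -big_mkcond /=.
apply: baireD; first by apply: IH => k kn; apply: bf; exact: ltnW.
by case: (P n); [exact: bf|exact: baire_cst].
Qed.

Lemma baire_prod xi (n : nat) (P : pred nat) (f : nat -> X -> R) :
  (forall k, (k < n)%N -> baire_class xi (f k)) ->
  baire_class xi (fun x => \prod_(k < n | P k) f k x).
Proof.
elim: n => [|n IH] bf.
  by under eq_fun do rewrite big_ord0; exact: baire_cst.
under eq_fun do rewrite big_mkcond big_ord_recr /= -big_mkcond /=.
apply: baireM; first by apply: IH => k kn; apply: bf; exact: ltnW.
by case: (P n); [exact: bf|exact: baire_cst].
Qed.

(** For a limit [xi] the classes of all the [f k] may be cofinal in [xi]; only finitely many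
    functions at a time fit into one class below [xi]. *)
Lemma baire_common xi (n : nat) (f : nat -> X -> R) : (\bot < xi)%O ->
  (forall k, exists2 eta, (eta < xi)%O & baire_class eta (f k)) ->
  exists2 eta, (eta < xi)%O & forall k, (k < n)%N -> baire_class eta (f k).
Proof.
move=> xi0 bf; elim: n => [|n [eta ex be]]; first by exists \bot%O.
have [eta' ex' be'] := bf n; exists (Order.max eta eta'); first by rewrite gt_max ex.
move=> k; rewrite ltnS leq_eqVlt => /orP[/eqP ->|/be].
  by apply: baire_le be'; rewrite le_max lexx orbT.
by apply: baire_le; rewrite le_max lexx.
Qed.

End BaireLemmas.

(** * Indicators of transfinite differences of Sigma^0_xi sets *)

Section BaireDifference.
Context {d : Order.disp_t} {W : omega1Type d} {R : realType} {X : topologicalType}.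
Context {m : X -> X -> R}.
Hypothesis mP : polish_dist m.
Implicit Types (xi : W) (S : set X).

(** [v] is the distance to the complement truncated at 1. Written as a supremum of radii, it also
    makes sense when the complement is empty. *)
Lemma open_cozero S : open S -> exists v : X -> R,
  [/\ continuous v, forall x, 0 <= v x <= 1 & forall x, S x <-> 0 < v x].
Proof.
move=> oS.
pose E x := [set r : R | 0 <= r <= 1 /\ forall y, m x y < r -> S y].
pose v x := sup (E x).
have E0 x : E x 0.
  by split=> [|y]; rewrite ?lexx ?ler01// ltNge (pd_ge0 mP).
have Eub x : has_ubound (E x) by exists 1 => r [/andP[]].
have v0 x : 0 <= v x by exact: ub_le_sup.
have v1 x : v x <= 1 by apply: ge_sup; [exists 0|move=> r [/andP[]]].
have lip x y : v x <= v y + m x y.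
  apply: ge_sup; first by exists 0.
  move=> r [/andP[r0 r1] rS]; have [rxy|rxy] := leP r (m x y).
    by have := v0 y; lra.
  suff : r - m x y <= v y by lra.
  apply: ub_le_sup => //; split; first by have := pd_ge0 mP x y; lra.
  by move=> z yz; apply: rS; have := pd_tri mP y x z; lra.
exists v; split=> [x|x|x].
- apply/cvgrPdist_lt => e e0; apply/(pd_nbhs mP); exists e => // y xy.
  rewrite ltr_norml; have := lip x y; have := lip y x; rewrite (pd_sym mP y x).
  by lra.
- by rewrite v0 v1.
- split=> [Sx|vx].
    have [r r0 rS] := (pd_open mP S).1 oS x Sx.
    have r1 : 0 < Num.min r 1 by rewrite lt_min r0 ltr01.
    apply: (lt_le_trans r1); apply: ub_le_sup => //; split.
      by rewrite (ltW r1) ge_min lexx orbT.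
    by move=> y; rewrite lt_min => /andP[/rS].
  have [r [_ rS] r0] := sup_gt (ex_intro _ 0 (E0 x)) vx.
  by apply: rS; rewrite (pd_refl mP).
Qed.

(** Stronger than pointwise convergence to the indicator: the value is exactly 0 off [S] and
    eventually exactly 1 on [S]. Exactness lets sums and products settle although their number of
    terms grows with the stage. *)
Definition switches_on S (u : nat -> X -> R) :=
  (forall n x, ~ S x -> u n x = 0) /\
  (forall x, S x -> \forall n \near \oo, u n x = 1).

Lemma switches_on_cvg S u : switches_on S u -> forall x, u n x @[n --> \oo] --> (\1_S x : R).
Proof.
move=> [u0 u1] x; rewrite indicE; case: (boolP (x \in S)) => /=.
  by rewrite inE => /u1 ux; apply: cvg_near_cst.
rewrite notin_setE => nSx; apply: cvg_near_cst.
by near=> n; rewrite u0.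
Unshelve. all: by end_near. Qed.

Lemma Sigma0_switches xi S : Sigma0 xi S ->
  exists2 u, switches_on S u &
    forall n, exists2 eta, (eta < xi)%O & baire_class eta (u n).
Proof.
elim=> [{}S oS|{}xi eta A e1 exi sA IH].
  have [v [cv v01 Sv]] := open_cozero oS.
  exists (fun n x => Num.min 1 (n%:R * v x)).
    split=> [n x nSx|x /Sv vx].
      have -> : v x = 0.
        apply/eqP; rewrite eq_le; have /andP[-> _] := v01 x.
        by rewrite leNgt andbT; apply/negP => /Sv.
      by rewrite mulr0 min_r.
    near=> n; rewrite min_l// -ler_pdivrMr// mul1r.
    by near: n; exact: nbhs_infty_ger.
  move=> n; exists \bot%O; first exact: lt0_oone.
  apply: baire_class0 => x.
  apply: (@continuous_min R X (fun=> 1) (fun x => n%:R * v x) x).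
    exact: cvg_cst.
  by apply: cvgM; [exact: cvg_cst|exact: cv].
have bA n : baire_class (eta n) (\1_(~` A n) : X -> R).
  have [u uS bu] := IH n.
  have /choice[z /all_and2[z1 z2]] k : exists z, (z < eta n)%O /\ baire_class z (u k).
    by have [z] := bu k; exists z.
  exact: (baire_class_lim z1 z2 (switches_on_cvg uS)).
(* The indicator of the union of the first [n] pieces. Its factors have classes [eta k], and
   [baire_common] puts finitely many of them below [xi]. *)
exists (fun n x => 1 - \prod_(k < n) \1_(~` A k) x).
  split=> [n x nAx|x [k _ Ax]].
    rewrite big1 ?subrr// => k _; rewrite indicE mem_set//= => Ax; apply: nAx.
    by exists k.
  exists k.+1 => // n /= kn; rewrite (bigD1 (Ordinal kn))//= indicE memNset ?mul0r ?subr0//.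
have xi0 : (\bot < xi)%O by apply: le_lt_trans (le0x _) (exi 0%N).
move=> n; have [|z zx bz] := @baire_common _ W R X xi n (fun k => \1_(~` A k)) xi0.
  by move=> k; exists (eta k).
by exists z => //; apply: baire_1B; apply: (@baire_prod _ W R X z n predT (fun k => \1_(~` A k))).
Unshelve. all: by end_near. Qed.

(* The approximations read off only the first [n] conditions, at stage [n]. *)
Lemma baire_difference xi (V : nat -> set X) (lab : pred nat) (prec : rel nat) :
  (\bot < xi)%O -> (forall k, V k = set0 \/ Sigma0 xi (V k)) ->
  (forall j k, prec j k -> ~~ prec k j) ->
  (forall x k, V k x -> exists2 k0, V k0 x & forall j, V j x -> j != k0 -> prec k0 j) ->
  baire_class xi
    (\1_[set x | exists k, [/\ lab k, V k x & forall j, prec j k -> ~ V j x]] : X -> R).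
Proof.
move=> xi0 sV asym least; set A := [set x | _].
have /choice[u uV] : forall k, exists u, switches_on (V k) u /\
    forall n, exists2 eta, (eta < xi)%O & baire_class eta (u n).
  move=> k; have [->|/Sigma0_switches[u ? ?]] := sV k; last by exists u.
  exists (fun=> fun=> 0); split; first by split=> // x [].
  by move=> n; exists \bot%O => //; exact: baire_cst.
(* Term [k] is on when the switch of [k] is on and those of its predecessors among the first [n] are
   off. *)
pose f n x := \sum_(k < n | lab k) (u k n x * \prod_(j < n | prec j k) (1 - u j n x)).
have bf n : exists z, (z < xi)%O /\ baire_class z (f n).
  have [k|z zx bz] := @baire_common _ W R X xi n (fun k => u k n) xi0.
    by have [_] := uV k.
  exists z; split=> //; apply: (@baire_sum _ W R X z n lab
    (fun k x => u k n x * \prod_(j < n | prec j k) (1 - u j n x))).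
  move=> k kn; apply: baireM; first exact: bz.
  apply: (@baire_prod _ W R X z n (fun j => prec j k) (fun j x => 1 - u j n x)) => j jn.
  by apply: baire_1B; exact: bz.
have /choice[z /all_and2[z1 z2]] := bf.
apply: (baire_class_lim z1 z2) => x.
have [[k Vk]|nV] := pselect (exists k, V k x); last first.
  have -> : \1_A x = 0 :> R.
    by rewrite indicE memNset// => -[k [_ Vk _]]; apply: nV; exists k.
  apply: cvg_near_cst; near=> n; rewrite /f big1// => k _.
  have [[u0 _] _] := uV k; rewrite u0 ?mul0r// => Vk; apply: nV; by exists k.
have {k Vk}[k Vk kmin] := least x k Vk.
apply: cvg_near_cst.
have [[_ /(_ x Vk) uk1] _] := uV k.
near=> n.
have kn : (k < n)%N by near: n; exact: nbhs_infty_gt.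
have ukn : u k n x = 1 by near: n; exact: uk1.
have u0 j : ~ V j x -> u j n x = 0 by have [[h _] _] := uV j; apply: h.
(* Either the switch of [j] is exactly 0, or [j] comes after [k] and its product contains the factor
   [1 - u k n x], which is 0. *)
have other j : j != k -> (j < n)%N -> u j n x * \prod_(i < n | prec i j) (1 - u i n x) = 0.
  move=> jk jn; have [Vj|/u0 ->] := pselect (V j x); last by rewrite mul0r.
  rewrite (bigD1 (Ordinal kn)) /= ?ukn ?subrr ?mul0r ?mulr0//.
  exact: kmin.
have self : u k n x * \prod_(i < n | prec i k) (1 - u i n x) = 1.
  rewrite ukn mul1r big1// => i ik; rewrite u0 ?subr0// => Vi.
  have ki : (i : nat) != k.
    by apply: contraTneq ik => ->; apply/negP => h; have := asym _ _ h; rewrite h.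
  by have := asym _ _ ik; rewrite kmin.
rewrite /f indicE; case: (boolP (lab k)) => labk.
  rewrite (bigD1 (Ordinal kn))//= self big1 ?addr0; last first.
    by move=> j /andP[_ jk]; exact: other.
  rewrite mem_set//; exists k; split=> // j jk Vj.
  have kj : j != k by apply: contraTneq jk => ->; apply/negP => h; have := asym _ _ h; rewrite h.
  by have := asym _ _ jk; rewrite kmin.
rewrite big1; last first.
  by move=> j labj; apply: other => //; apply: contraNneq labk => <-.
rewrite memNset// => -[j [labj Vj jmin]].
have jk : j != k by apply: contraNneq labk => <-.
exact: (jmin k (kmin j Vj jk)).
Unshelve. all: by end_near. Qed.

End BaireDifference.

(** * Ranks *)

Section RankValues.
Context {d : Order.disp_t} {W : omega1Type d}.
Implicit Types (A : set W) (S : set (option W)) (a b c : W).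

Lemma omin_ex A a : A a -> exists b, [/\ omin A = Some b, A b & (b <= a)%O].
Proof.
move=> Aa; rewrite /omin; case: xgetP => [r _ [b [Ab bmin] <-]|/= h].
  by exists b; split=> //; exact: bmin.
have [b lb] := least_ex (ex_intro _ a Aa).
by exfalso; apply: (h (Some b)); exists b.
Qed.

Lemma omin_Some A b : omin A = Some b -> A b.
Proof. by rewrite /omin; case: xgetP => [r _ [c [Ac _] <-] [<-]|]. Qed.

Lemma sup_rank_ex S c : (forall r, S r -> le_opt r (Some c)) ->
  exists2 b, sup_rank S = Some b & (b <= c)%O.
Proof.
move=> Sc; have [b [E _ bc]] := @omin_ex [set a | forall r, S r -> le_opt r (Some a)] c Sc.
by exists b.
Qed.

Lemma sup_rank_ub S c r : sup_rank S = Some c -> S r -> le_opt r (Some c).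
Proof. by move=> /omin_Some /=; exact. Qed.

Lemma countable_ge_min zeta S : (exists a, S (Some a)) ->
  (forall a, S (Some a) -> (zeta <= a)%O) -> countable_ge zeta (min_rank S).
Proof.
move=> [a Sa] h; have [b [E Sb _]] := @omin_ex [set a | S (Some a)] a Sa.
by rewrite /min_rank E /=; exact: h.
Qed.

Context {T : Type}.
Implicit Types (D : set T -> set T).

(** The hypothesis concerns only the iterates because [der_sep] shrinks closed sets but not
    arbitrary ones. *)
Lemma iter_der_sub D : (forall a, D (iter_der D a) `<=` iter_der D a) ->
  forall a b : W, (a <= b)%O -> iter_der D b `<=` iter_der D a.
Proof.
move=> DF a b; elim/(well_founded_ind (@omega1_wf d W)): b => b IH.
rewrite le_eqVlt => /orP[/eqP ->//|ab].
have [[c E]|nb] := pselect (exists c, b = osucc c).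
  rewrite E iter_derS in ab IH *; apply: subset_trans (DF _) _.
  by apply: IH; [exact: lt_osucc|exact: ltS_le].
rewrite iter_der_lim => [|c bc]; last by apply: nb; exists c.
by move=> x; apply.
Qed.

(** Comparison of the two derivatives and monotonicity are merged into one hypothesis, restricted to
    iterates of [D1] so that their closedness can be used. *)
Lemma iter_der_mono D1 D2 :
  (forall (a : W) G, iter_der D1 a `<=` G -> D1 (iter_der D1 a) `<=` D2 G) ->
  forall a : W, iter_der D1 a `<=` iter_der D2 a.
Proof.
move=> h a; elim/(well_founded_ind (@omega1_wf d W)): a => a IH.
have [[c E]|na] := pselect (exists c, a = osucc c).
  by rewrite E !iter_derS in IH *; apply: h; apply: IH; exact: lt_osucc.
rewrite !iter_der_lim; try by move=> c ac; apply: na; exists c.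
by move=> x h' b ba; exact: (IH b ba) (h' b ba).
Qed.

Lemma rk_le D c : iter_der D c = set0 -> le_opt (rk D) (Some c).
Proof.
move=> Dc; have [b [E _ bc]] := @omin_ex [set a | iter_der D a = set0] c Dc.
by rewrite /rk E.
Qed.

Lemma rk_leP D (c : W) : (forall a : W, D (iter_der D a) `<=` iter_der D a) ->
  le_opt (rk D) (Some c) -> iter_der D c = set0.
Proof.
move=> DF; case E : (rk D) => [b|//] /= bc.
rewrite -subset0; apply: subset_trans (iter_der_sub DF bc) _.
by rewrite (omin_Some E).
Qed.

End RankValues.

(** * The three derivatives and their pointwise comparison *)

Section Derivatives.
Context {d : Order.disp_t} {W : omega1Type d} {R : realType} {X : topologicalType}.
Implicit Types (f : X -> R) (F G A B : set X) (g : nat -> X -> R) (e s : R) (a c : W).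

Lemma iter_der_closed (D : set X -> set X) : (forall F, closed F -> closed (D F)) ->
  forall a, closed (iter_der D a).
Proof.
move=> cD a; elim/(well_founded_ind (@omega1_wf d W)): a => a IH.
have [[c E]|na] := pselect (exists c, a = osucc c).
  by rewrite E iter_derS in IH *; apply: cD; apply: IH; exact: lt_osucc.
rewrite iter_der_lim; last by move=> c ac; apply: na; exists c.
by apply: closed_bigI => b; exact: IH.
Qed.

(** If no iterate were empty, every step would be strict, since fixed closed sets are empty. Step
    [a] then yields a basic open set that meets [D^a] but misses [D^(a+1)]. As the iterates
    decrease, these sets have distinct indices, and [W] would inject into [nat]. *)
Lemma iter_der_stops (D : set X -> set X) (Bs : nat -> set X) :
  (forall n, open (Bs n)) ->
  (forall x U, open U -> U x -> exists n, Bs n x /\ Bs n `<=` U) ->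
  (forall F, closed F -> closed (D F)) -> (forall F, D F `<=` F) ->
  (forall F, closed F -> F `<=` D F -> F = set0) ->
  exists a, iter_der D a = set0.
Proof.
move=> oB baseB cD DF D0; apply: contrapT => nD.
have cI := iter_der_closed cD.
have /choice[n nP] a : exists n, (Bs n `&` iter_der D a !=set0) /\
    Bs n `&` iter_der D (osucc a) = set0.
  have : ~ iter_der D a `<=` D (iter_der D a).
    by move=> h; apply: nD; exists a; exact: D0 h.
  rewrite -iter_derS => /existsNP[x /not_implyP[ax nax]].
  have [n [nx nU]] := baseB x (~` iter_der D (osucc a)) (closed_openC (cI _)) nax.
  exists n; split; first by exists x.
  by rewrite -subset0 => y [/nU].
apply: (@omega1_uncountable d W); apply/countable_injP; exists n => a b _ _ nab.
have key a' b' : n a' = n b' -> ~ (a' < b')%O.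
  move=> E ab; have [_ h] := nP a'; have [[y [By Dy]] _] := nP b'.
  suff : set0 y by [].
  rewrite -h; split; first by rewrite E.
  by apply: (iter_der_sub (fun a => DF (iter_der D a)) (osucc_le ab)).
by have [/(key _ _ nab)|/(key _ _ (esym nab))|] := ltgtP a b.
Qed.

Lemma ereal_sup_ltP (S : set (\bar R)) e : (ereal_sup S < e%:E)%E ->
  exists2 s, s < e & forall r : R, S r%:E -> r <= s.
Proof.
have ub := @ereal_sup_ubound _ S.
case: (ereal_sup S) ub => [s| |] ub //= h.
- by exists s => // r /ub; rewrite lee_fin.
(* The supremum is -oo, as for an empty set; any real below [e] serves. *)
- exists (e - 1); first by lra.
  by move=> r /ub; rewrite leeNy_eq.
Qed.

(** Replaces the infimum of extended-real suprema by real inequalities. The slack [s < e] is there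
    because a supremum need not be attained. *)
Lemma der_oscP f e F x : der_osc f e F x <-> F x /\
  forall U s, open_nbhs x U -> s < e ->
    exists y1 y2, [/\ (U `&` F) y1, (U `&` F) y2 & s < `|f y1 - f y2|].
Proof.
split=> -[Fx h]; split=> //.
  move=> U s Ux se; apply: contrapT => n.
  have : (e%:E <= s%:E)%E; last by rewrite lee_fin leNgt se.
  apply: le_trans h _; apply: le_trans (ereal_inf_lbound _) _.
    by exists U; [exact: Ux|reflexivity].
  apply: ge_ereal_sup => _ [[y1 y2] /= [Uy1 Uy2] <-]; rewrite lee_fin leNgt.
  by apply/negP => lt; apply: n; exists y1, y2.
apply: le_ereal_inf_tmp => _ [U Ux <-]; rewrite leNgt; apply/negP.
move=> /ereal_sup_ltP[s se sS]; have [y1 [y2 [h1 h2]]] := h U s Ux se.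
by rewrite ltNge sS//; exists (y1, y2).
Qed.

Lemma der_seqP g e F x : der_seq g e F x <-> F x /\
  forall U N s, open_nbhs x U -> s < e ->
    exists m n y, [/\ (N <= m)%N, (N <= n)%N, (U `&` F) y & s < `|g m y - g n y|].
Proof.
split=> -[Fx h]; split=> //.
  move=> U N s Ux se; apply: contrapT => nh.
  have : (e%:E <= s%:E)%E; last by rewrite lee_fin leNgt se.
  apply: le_trans h _; apply: le_trans (ereal_inf_lbound _) _.
    by exists U; [exact: Ux|reflexivity].
  apply: le_trans (ereal_inf_lbound _) _; first by exists N; [|reflexivity].
  apply: ge_ereal_sup => _ [m [n [y [Nm Nn Uy ->]]]]; rewrite lee_fin leNgt.
  by apply/negP => lt; apply: nh; exists m, n, y.
apply: le_ereal_inf_tmp => _ [U Ux <-].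
apply: le_ereal_inf_tmp => _ [N _ <-]; rewrite leNgt; apply/negP.
move=> /ereal_sup_ltP[s se sS]; have [m [n [y [h1 h2 h3]]]] := h U N s Ux se.
by rewrite ltNge sS//; exists m, n, y.
Qed.

Lemma der_osc_sub f e F : der_osc f e F `<=` F.
Proof. by move=> x []. Qed.

Lemma der_seq_sub g e F : der_seq g e F `<=` F.
Proof. by move=> x []. Qed.

Lemma der_sep_closed A B F : closed (der_sep A B F).
Proof. by apply: closedI; exact: closed_closure. Qed.

Lemma iter_der_sep_closed A B a : closed (iter_der (der_sep A B) a).
Proof. by apply: iter_der_closed => F _; exact: der_sep_closed. Qed.

Lemma der_sep_sub A B F : closed F -> der_sep A B F `<=` F.
Proof. by move=> cF x [/(closure_subset (@subIsetl _ F A)) /cF]. Qed.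

Lemma der_sep_osc f (p q : R) F G : closed F -> F `<=` G ->
  der_sep [set x | f x <= p] [set x | q <= f x] F `<=` der_osc f (q - p) G.
Proof.
move=> cF FG x DFx; apply/der_oscP; split; first by apply: FG; exact: (der_sep_sub cF DFx).
case: DFx => Ax Bx U s Ux spq.
have nU : nbhs x U by exact: open_nbhs_nbhs.
have [y [[Fy /= Ay] Uy]] := Ax U nU; have [z [[Fz /= Bz] Uz]] := Bx U nU.
exists z, y; split; [by split=> //; exact: FG|by split=> //; exact: FG|].
by apply: lt_le_trans (ler_norm _); lra.
Qed.

(** Outside the derivative of the sequence, a tail of [g] stays, near [x], within some [s < e / 3]
    of its limit. The oscillation of [f] is then at most two such errors plus the oscillation of a
    single continuous [g N]. *)
Lemma der_osc_seq f g e F G : (forall n, continuous (g n)) ->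
  (forall x, g n x @[n --> \oo] --> f x) -> F `<=` G ->
  der_osc f e F `<=` der_seq g (e / 3) G.
Proof.
move=> cg gf FG x /der_oscP[Fx h]; apply/der_seqP; split; first exact: FG.
move=> U N s Ux se; apply: contrapT => n.
have small y : (U `&` F) y -> `|f y - g N y| <= s.
  move=> [Uy Fy]; apply/ler_addgt0Pr => r r0.
  have /cvgrPdist_lt/(_ r r0) fr := gf y.
  near \oo => k.
  have kN : (N <= k)%N by near: k; exact: nbhs_infty_ge.
  have : `|f y - g k y| < r by near: k; exact: fr.
  have : `|g k y - g N y| <= s.
    rewrite leNgt; apply/negP => lt; apply: n; exists k, N, y; split=> //.
    by split=> //; exact: FG.
  by have := ler_distD (g k y) (f y) (g N y); lra.
(* Chosen so that [2 * s + 2 * t], which equals [(e + s) / 2], is below [e]. *)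
pose t := (e - 3 * s) / 4.
have t0 : 0 < t by rewrite /t; lra.
have /cvgrPdist_lt/(_ t t0) := cg N x.
move=> Nt; have : nbhs x [set y | `|g N x - g N y| < t] := Nt.
rewrite nbhsE => -[V [oV Vx] Vt].
have [||y1 [y2 [[[Uy1 Vy1] Fy1] [[Uy2 Vy2] Fy2] lt]]] := h (U `&` V) (2 * s + 2 * t).
- by case: Ux => oU Ux; split=> //; exact: openI.
- by rewrite /t; have := le_trans (normr_ge0 _) (small x (conj Ux.2 Fx)); lra.
have := Vt _ Vy1; have := Vt _ Vy2; have := small _ (conj Uy1 Fy1).
have := small _ (conj Uy2 Fy2); move: lt; rewrite /=.
have := ler_distD (g N y1) (f y1) (f y2); have := ler_distD (g N x) (g N y1) (f y2).
have := ler_distD (g N y2) (g N x) (f y2).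
by rewrite (distrC (g N y1) (g N x)) (distrC (g N y2) (f y2)); lra.
Unshelve. all: by end_near. Qed.

Lemma der_seq_mono g e e' F G : e' <= e -> F `<=` G -> der_seq g e F `<=` der_seq g e' G.
Proof.
move=> ee FG x /der_seqP[Fx h]; apply/der_seqP; split; first exact: FG.
move=> U N s Ux se; have [m [n [y [? ? [? ?] ?]]]] := h U N s Ux (lt_le_trans se ee).
by exists m, n, y; split=> //; split=> //; exact: FG.
Qed.

Lemma der_seq_closed g e F : closed F -> closed (der_seq g e F).
Proof.
move=> cF x clx; have Fx : F x.
  by apply: cF; apply: closure_subset clx; exact: der_seq_sub.
apply/der_seqP; split=> // U N s Ux se.
have [y [/der_seqP[Fy h] Uy]] := clx U (open_nbhs_nbhs Ux).
by apply: h => //; case: Ux.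
Qed.

(** Baire category: in a non-empty fixed [F], every ball around a point of [F] contains a smaller
    one on which two late terms of [g] differ by more than [e / 2]. At the common point of such
    nested balls [g] cannot converge. *)
Lemma der_seq_fixed (m : X -> X -> R) f g e F : polish_dist m ->
  (forall n, continuous (g n)) -> (forall x, g n x @[n --> \oo] --> f x) ->
  0 < e -> closed F -> F `<=` der_seq g e F -> F = set0.
Proof.
move=> mP cg gf e0 cF FD; apply: contrapT => /eqP/set0P[x0 Fx0].
pose good (p : X * R) := F p.1 /\ 0 < p.2.
pose next (k : nat) (p q : X * R) := [/\ good q,
  forall z, m q.1 z <= q.2 -> m p.1 z <= p.2, q.2 < k.+1%:R^-1 &
  exists i j, [/\ (k <= i)%N, (k <= j)%N &
     forall z, m q.1 z <= q.2 -> e / 2 < `|g i z - g j z|]].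
have /choice[nx nxP] kp : exists q, good kp.2 -> next kp.1 kp.2 q.
  have [gp|] := pselect (good kp.2); last by move=> ?; exists kp.2.
  case: kp gp => k [x r] [/= Fx r0].
  have /FD/der_seqP[_ h] := Fx.
  have [||i [j [y [ki kj [xy Fy] lt]]]] := h [set y | m x y < r] k (e / 2).
  - by split; [exact: (pd_ball_open mP)|rewrite /= (pd_refl mP)].
  - by lra.
  have cD : continuous (fun z => g i z - g j z).
    by move=> z; apply: cvgB; exact: cg.
  have : `|g i z - g j z| @[z --> y] --> `|g i y - g j y|.
    by apply: cvg_norm; exact: cD.
  move=> /cvgrPdist_lt /(_ (`|g i y - g j y| - e / 2)); rewrite subr_gt0 => /(_ lt).
  move=> Ny; have : nbhs y [set z | `| `|g i y - g j y| - `|g i z - g j z| | <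
    `|g i y - g j y| - e / 2] := Ny.
  move=> /(pd_nbhs mP)[t t0 th].
  (* The three bounds keep the gap above [e / 2] on the closed ball, keep that ball inside the
     previous one, and force the radii to 0. *)
  pose r' := Num.min (t / 2) (Num.min ((r - m x y) / 2) (k.+1%:R^-1 / 2)).
  have k0 : 0 < k.+1%:R^-1 :> R by rewrite invr_gt0.
  have /= xyr : m x y < r := xy.
  have r'0 : 0 < r' by rewrite !lt_min !divr_gt0 ?subr_gt0.
  have [r1 r2 r3] : [/\ r' <= t / 2, r' <= (r - m x y) / 2 & r' <= k.+1%:R^-1 / 2].
    by rewrite /r' !ge_min !lexx !orbT.
  exists (y, r') => _; split=> //=.
  - move=> z yz; have := pd_tri mP y x z; lra.
  - by move: k0 r3; set c := _^-1; lra.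
  - exists i, j; split=> // z yz; have /th : m y z < t by lra.
    by rewrite /= ltr_norml => /andP[_]; lra.
pose p := fix p k := if k is k'.+1 then nx (k', p k') else (x0, 1).
have gp k : good (p k).
  elim: k => [|k IH]; first by split=> //; exact: ltr01.
  by have [] := nxP (k, p k) IH.
have np k : next k (p k) (p k.+1) := nxP (k, p k) (gp k).
have [||k|l lin _] := @pd_nested _ _ _ mP (fun k => (p k).1) (fun k => (p k).2).
- by move=> k y; have [_ h _ _] := np k; exact: h.
- move=> t t0; have [k /= _ /(_ k (leqnn k)) kt] := near_infty_natSinv_lt (PosNum t0).
  by exists k.+1; have [_ _ h _] := np k; exact: lt_trans kt.
- by have [_ /ltW] := gp k.
(* Two terms within [e / 4] of the limit differ by less than [e / 2]. *)
have e4 : 0 < e / 4 by lra.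
have /cvgrPdist_lt/(_ _ e4) [k _ kP] := gf l.
have [_ _ _ [i [j [ki kj h]]]] := np k.
have := h l (lin _); have := kP i ki; have := kP j kj => /=.
have := ler_distD (f l) (g i l) (g j l); rewrite (distrC (g i l) (f l)).
by lra.
Qed.

End Derivatives.

(** * The inequalities alpha <= beta <= gamma and countability of gamma *)

Section RankComparison.
Context {d : Order.disp_t} {W : omega1Type d} {R : realType} {X : topologicalType}.
Implicit Types (f : X -> R) (g : nat -> X -> R) (c : W).

Lemma alpha_rk f c : alpha f = Some c -> forall p q : rat, p < q ->
  iter_der (der_sep [set x | f x <= ratr p] [set x | f x >= ratr q]) c = set0.
Proof.
move=> fc p q pq; apply: rk_leP.
  by move=> a; apply: der_sep_sub; exact: iter_der_sep_closed.
by apply: (sup_rank_ub fc); exists (p, q).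
Qed.

Lemma beta_rk f c : beta f = Some c -> forall e, 0 < e -> iter_der (der_osc f e) c = set0.
Proof.
move=> fc e e0; apply: rk_leP => [a|]; first exact: der_osc_sub.
by apply: (sup_rank_ub fc); exists e.
Qed.

Lemma gamma_rk f c : gamma f = Some c -> exists g : nat -> X -> R,
  [/\ forall n, continuous (g n), forall x, g n x @[n --> \oo] --> f x &
    forall e, 0 < e -> iter_der (der_seq g e) c = set0].
Proof.
move=> /omin_Some /= [g [cg gf] gc]; exists g; split=> // e e0.
apply: rk_leP => [a|]; first exact: der_seq_sub.
by apply: (sup_rank_ub gc); exists e.
Qed.

Lemma gamma_beta f c : gamma f = Some c -> exists2 b, beta f = Some b & (b <= c)%O.
Proof.
move=> /gamma_rk[g [cg gf gc]]; apply: sup_rank_ex => _ [e /= e0 <-].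
apply: rk_le; rewrite -subset0 -(gc (e / 3)) ?divr_gt0//.
by apply: iter_der_mono => a G; exact: (der_osc_seq cg gf).
Qed.

Lemma beta_alpha f c : beta f = Some c -> exists2 a, alpha f = Some a & (a <= c)%O.
Proof.
move=> fc; apply: sup_rank_ex => _ [[p q] /= pq <-].
apply: rk_le; rewrite -subset0 -(beta_rk fc (e := ratr q - ratr p)) ?subr_gt0 ?ltr_rat//.
apply: iter_der_mono => a G; apply: der_sep_osc; exact: iter_der_sep_closed.
Qed.

(** The derivative shrinks as [e] grows, so the values [e = 1/(n+1)] suffice, and their countably
    many ordinals have a common bound. *)
Lemma gamma_countable (m : X -> X -> R) f : polish_dist m -> baire_class (oone : W) f ->
  exists c : W, gamma f = Some c.
Proof.
move=> mP /(baire_normal lt0_oone)[eta [g [e1 bg gf]]].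
have cg n : continuous (g n).
  by apply: (@baire0_inv _ W); rewrite -(lt_oone (e1 n)).
have [Bs [oB bB]] := pd_base mP.
have /choice[a aP] n : exists a : W, iter_der (der_seq g n.+1%:R^-1) a = set0.
  apply: (iter_der_stops oB bB) => [F|F|F].
  - exact: der_seq_closed.
  - exact: der_seq_sub.
  - by apply: (der_seq_fixed mP cg gf); rewrite ?invr_gt0 ?ltr0Sn.
have [b ab] := omega1_sup a.
pose S : set (option W) := [set rk (der_seq g e) | e in [set e : R | 0 < e]].
have [|c Sc _] := @sup_rank_ex _ W S b.
  move=> _ [e e0 <-]; apply: rk_le; rewrite -subset0.
  have [k /= _ /(_ k (leqnn k)) kt] := near_infty_natSinv_lt (PosNum e0).
  rewrite -(aP k); apply: subset_trans (iter_der_sub _ (ab k)).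
    by apply: iter_der_mono => z G; apply: der_seq_mono; exact: ltW.
  by move=> z; exact: der_seq_sub.
rewrite /gamma /min_rank; set A : set W := [set a | _].
have Ac : A c by exists g.
by have [c' [E _ _]] := omin_ex Ac; exists c'.
Qed.

End RankComparison.

(** * Polish refinements *)

Lemma metric_topology (R : realType) (X : topologicalType) (m : X -> X -> R) :
  (forall x, m x x = 0) -> (forall x y, m x y = 0 -> x = y) ->
  (forall x y, m x y = m y x) -> (forall y x z, m x z <= m x y + m y z) ->
  exists t : Topological X, forall U : set X, @open (Topological.Pack t) U <->
    forall x, U x -> exists2 r : R, 0 < r & forall y, m x y < r -> U y.
Proof.
move=> mxx m0 ms mt.
pose MB := @isMetric.Build R X m mxx m0 ms mt.
pose MT : metricType R := HB.pack (X : Type) (Choice.class X) MB.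
exists (Topological.class MT) => U; split=> [oU x Ux|oU].
  have : @nbhs MT MT x U by exact: open_nbhs_nbhs.
  by rewrite -(@metricType_numDomainType.filter_from_mdist_nbhs R MT) => -[r r0 rU]; exists r.
rewrite openE => x Ux; rewrite /interior.
suff : @nbhs MT MT x U by [].
rewrite -(@metricType_numDomainType.filter_from_mdist_nbhs R MT).
by have [r r0 rU] := oU x Ux; exists r.
Qed.

Lemma real_cauchy_cvg (R : realType) (a : nat -> R) :
  (forall e : R, 0 < e -> exists N, forall i j, (N <= i)%N -> (N <= j)%N -> `|a i - a j| < e) ->
  exists c : R, a n @[n --> \oo] --> c.
Proof.
move=> ca; suff : cvg (a n @[n --> \oo]) by move=> h; exists (lim (a n @[n --> \oo])).
apply: cauchy_cvg; apply/cauchy_ballP => e e0; have [N Na] := ca e e0.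
exists ([set a n | n in [set n | (N <= n)%N]], [set a n | n in [set n | (N <= n)%N]]).
  by split; exists N => // n /= Nn; exists n.
by move=> [_ _] [[i Ni <-] [j Nj <-]]; exact: Na.
Qed.

Lemma near_lt_forall (P : nat -> nat -> Prop) K :
  (forall k, \forall n \near \oo, P k n) ->
  \forall n \near \oo, forall k, (k < K)%N -> P k n.
Proof.
move=> h; elim: K => [|K IH]; first by near=> n.
near=> n => k; rewrite ltnS leq_eqVlt => /orP[/eqP ->|].
  by near: n; exact: h.
by move: k; near: n; exact: IH.
Unshelve. all: by end_near. Qed.

Lemma nat_cvg_stationary (R : realType) (a : nat -> nat) (c : R) :
  (a n)%:R @[n --> \oo] --> c ->
  exists2 j, c = j%:R & \forall n \near \oo, a n = j.
Proof.
move=> /cvgrPdist_lt ac; have h2 : 0 < 2^-1 :> R by rewrite invr_gt0.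
have [M _ Mh] := ac _ h2.
have st n : (M <= n)%N -> a n = a M.
  move=> Mn; have := Mh _ Mn; have := Mh _ (leqnn M) => /= h3 h4.
  have : `|(a n)%:R - (a M)%:R| < 1 :> R.
    by have := ler_distD c (a n)%:R (a M)%:R; rewrite (distrC (a n)%:R c); lra.
  have [le|le] := leqP (a n) (a M).
    rewrite distrC -natrB// normr_nat -[1]/(1%:R) ltr_nat ltnS leqn0 subn_eq0 => ge.
    by apply/eqP; rewrite eqn_leq le ge.
  rewrite -natrB ?(ltnW le)// normr_nat -[1]/(1%:R) ltr_nat ltnS leqn0 subn_eq0 => ge.
  by apply/eqP; rewrite eqn_leq ge ltnW.
have stn : \forall n \near \oo, a n = a M by exists M.
exists (a M) => //.
have cj : (a n)%:R @[n --> \oo] --> ((a M)%:R : R).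
  by apply: cvg_near_cst; apply: filterS stn => n ->.
apply: (@cvg_unique R (@Rhausdorff R) _ _ _ _ _ cj).
exact/cvgrPdist_lt.
Qed.

Section Refinement.
Context {d : Order.disp_t} {W : omega1Type d} {R : realType} {X : topologicalType}.
Context {m : X -> X -> R}.
Hypothesis mP : polish_dist m.
Implicit Types (xi : W) (H : nat -> X -> R) (N : X -> R).

(* The graph of [H], as a subset of [X] times the countable power of the reals,
   is closed. *)
Definition closed_graph H := forall (u : nat -> X) (x : X) (c : nat -> R),
  u n @[n --> \oo] --> x -> (forall k, H k (u n) @[n --> \oo] --> c k) ->
  forall k, c k = H k x.

Lemma Sigma0_lt_forall xi (S : nat -> set X) n : (oone <= xi)%O ->
  (forall k, Sigma0 xi (S k)) -> Sigma0 xi [set x | forall k, (k < n)%N -> S k x].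
Proof.
move=> xi1 SS; elim: n => [|n IH].
  by rewrite (_ : [set x | _] = setT); [apply: (Sigma0_openS mP xi1); exact: openT|apply/seteqP].
have -> : [set x | forall k, (k < n.+1)%N -> S k x] =
    [set x | forall k, (k < n)%N -> S k x] `&` S n.
  apply/seteqP; split=> x /=.
    by move=> h; split; [move=> k kn; apply: h; exact: ltnW|exact: h].
  by move=> [h Sn] k; rewrite ltnS leq_eqVlt => /orP[/eqP ->|/h].
exact: (Sigma0I mP).
Qed.

Section RefinedMetric.
Variable H : nat -> X -> R.

Let tr k x y : R := Num.min k.+1%:R^-1 `|H k x - H k y|.
(** The metric of the product of [X] with countably many real lines, restricted to the graph of [H].
    Truncating coordinate [k] at 1/(k+1) leaves finitely many relevant coordinates at each scale. *)
Definition graph_dist x y : R := Num.max (m x y) (sup (range (fun k => tr k x y))).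

Let k0 k : 0 < k.+1%:R^-1 :> R. Proof. by rewrite invr_gt0. Qed.

Let tr_ub x y : has_ubound (range (fun k => tr k x y)).
Proof.
exists 1 => _ [k _ <-]; rewrite /tr ge_min; apply/orP; left.
by rewrite invf_le1// ler1n.
Qed.

Let tr_le k x y : tr k x y <= graph_dist x y.
Proof. by rewrite le_max; apply/orP; right; apply: ub_le_sup => //; exists k. Qed.

Let m_le x y : m x y <= graph_dist x y.
Proof. by rewrite le_max lexx. Qed.

Let graph_dist_le x y e : m x y <= e -> (forall k, tr k x y <= e) -> graph_dist x y <= e.
Proof.
move=> h1 h2; rewrite ge_max h1; apply: ge_sup; first by exists (tr 0 x y), 0%N.
by move=> _ [k _ <-].
Qed.

Let graph_dist_lt k x y e : e <= k.+1%:R^-1 -> graph_dist x y < e -> `|H k x - H k y| < e.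
Proof.
move=> ek; move=> /(le_lt_trans (tr_le k x y)); rewrite /tr gt_min => /orP[|//].
by rewrite ltNge ek.
Qed.

Let gd_refl x : graph_dist x x = 0.
Proof.
apply/eqP; rewrite eq_le; apply/andP; split; last first.
  by have := m_le x x; rewrite (pd_refl mP).
apply: graph_dist_le.
  by rewrite (pd_refl mP).
by move=> k; rewrite /tr subrr normr0 ge_min lexx orbT.
Qed.

Let gd_eq x y : graph_dist x y = 0 -> x = y.
Proof.
move=> h; apply: (pd_eq mP); apply/eqP.
by rewrite eq_le (pd_ge0 mP) -h m_le.
Qed.

Let gd_sym x y : graph_dist x y = graph_dist y x.
Proof.
suff h a b : graph_dist a b <= graph_dist b a by apply/eqP; rewrite eq_le !h.
apply: graph_dist_le; first by rewrite (pd_sym mP) m_le.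
by move=> k; rewrite /tr distrC; exact: tr_le.
Qed.

Let gd_tri y x z : graph_dist x z <= graph_dist x y + graph_dist y z.
Proof.
apply: graph_dist_le; first by apply: le_trans (pd_tri mP y x z) _; exact: lerD.
move=> k; apply: le_trans (lerD (tr_le k x y) (tr_le k y z)).
have := k0 k; rewrite /tr; set c := _^-1 => c0.
have := ler_distD (H k y) (H k x) (H k z).
have := normr_ge0 (H k x - H k y); have := normr_ge0 (H k y - H k z).
move: `|H k x - H k y| `|H k y - H k z| `|H k x - H k z| => a b e a0 b0 ab.
by rewrite ge_min; case: (leP c a) => ?; case: (leP c b) => ?; apply/orP;
  first [by left; lra | by right; lra].
Qed.

Definition graph_box (B : nat -> set X) (c : nat * seq (rat * rat)) : set X :=
  [set x | B c.1 x /\ forall k, (k < size c.2)%N ->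
     ratr (nth (0, 0) c.2 k).1 < H k x < ratr (nth (0, 0) c.2 k).2].

(** The rational boxes form a countable family fine enough to give both separability and the class
    of the new open sets. *)
Lemma graph_box_small (B : nat -> set X) :
  (forall x U, open U -> U x -> exists n, B n x /\ B n `<=` U) ->
  forall x (e : R), 0 < e -> exists2 c, graph_box B c x &
    forall y, graph_box B c y -> graph_dist x y < e.
Proof.
move=> bB x e e0; have e2 : 0 < e / 2 by lra.
have [K /= _ /(_ K (leqnn K)) Ke] := near_infty_natSinv_lt (PosNum e2).
have mxx : m x x < e / 2 by rewrite (pd_refl mP).
have [n [nx nU]] := bB x _ (pd_ball_open mP x (e / 2)) mxx.
have /choice[pq pqP] k : exists pq : rat * rat,
    [/\ ratr pq.1 < H k x, H k x < ratr pq.2 & ratr pq.2 - ratr pq.1 < e / 2 :> R].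
  have [|q] := @rat_in_itvoo R (H k x) (H k x + e / 4); first by lra.
  have [|p] := @rat_in_itvoo R (H k x - e / 4) (H k x); first by lra.
  by rewrite !in_itv /= => /andP[p1 p2] /andP[q1 q2]; exists (p, q); split=> //=; lra.
(* Coordinates up to [K] are confined to intervals of length below [e / 2]; for the later ones the
   truncation is already below [e / 2]. *)
exists (n, mkseq pq K.+1).
  split=> // k; rewrite size_mkseq => kK; rewrite nth_mkseq//.
  by have [-> -> _] := pqP k.
move=> y [/nU /= xy h]; suff : graph_dist x y <= e / 2 by lra.
apply: graph_dist_le; first exact: ltW.
move=> k; rewrite /tr ge_min; apply/orP; have [kK|Kk] := ltnP k K.+1.
  right; have ks : (k < size (mkseq pq K.+1))%N by rewrite size_mkseq.
  have : ratr (nth (0, 0) (mkseq pq K.+1) k).1 < H k y <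
    ratr (nth (0, 0) (mkseq pq K.+1) k).2 := h k ks.
  rewrite nth_mkseq// => /andP[h1 h2].
  have [h3 h4 h5] := pqP k; rewrite ler_norml; lra.
left; apply: le_trans (ltW Ke); rewrite lef_pV2 ?posrE ?ltr0Sn// ler_nat.
exact: ltnW.
Qed.

Lemma graph_open_Sigma0 xi (U : set X) : (oone <= xi)%O ->
  (forall k O, open O -> Sigma0 xi (H k @^-1` O)) ->
  (forall x, U x -> exists2 r : R, 0 < r & forall y, graph_dist x y < r -> U y) ->
  Sigma0 xi U.
Proof.
move=> xi1 mH oU; have [B [oB bB]] := pd_base mP.
pose C n : set X := if unpickle n is Some c then
  (if pselect (graph_box B c `<=` U) then graph_box B c else set0) else set0.
have -> : U = \bigcup_n C n.
  apply/seteqP; split=> [x Ux|x [n _]]; last first.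
    by rewrite /C; case: unpickle => [c|//]; case: pselect => // h; exact: h.
  have [r r0 rU] := oU x Ux; have [c cx cr] := graph_box_small bB x r0.
  exists (pickle c) => //; rewrite /C pickleK; case: pselect => // -[] y cy.
  by apply: rU; exact: cr.
have s0 : Sigma0 xi (set0 : set X) by apply: (Sigma0_openS mP xi1); exact: open0.
apply: Sigma0_bigcupS => n; rewrite /C; case: unpickle => [c|//]; case: pselect => //= _.
have -> : graph_box B c = B c.1 `&` [set x | forall k, (k < size c.2)%N ->
   (H k @^-1` [set r | ratr (nth (0, 0) c.2 k).1 < r < ratr (nth (0, 0) c.2 k).2]) x] by [].
apply: (Sigma0I mP); first exact: (Sigma0_openS mP xi1).
apply: Sigma0_lt_forall => // k; apply: mH.
rewrite (_ : [set r | _] = [set` `](ratr (nth (0, 0) c.2 k).1 : R), ratr (nth (0, 0) c.2 k).2[ ]).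
  exact: itv_open.
by apply/seteqP; split=> r /=; rewrite in_itv.
Qed.

Lemma refinement_of_graph xi : (oone <= xi)%O -> closed_graph H ->
  (forall k O, open O -> Sigma0 xi (H k @^-1` O)) ->
  exists t : Topological X, let Xt : topologicalType := Topological.Pack t in
    [/\ exists mt : Xt -> Xt -> R, polish_dist mt, @open X `<=` @open Xt,
      @open Xt `<=` @Sigma0 d W X xi & forall k O, open O -> @open Xt (H k @^-1` O)].
Proof.
move=> xi1 cH mH.
have [t tP] := metric_topology gd_refl gd_eq gd_sym gd_tri; exists t => Xt.
have [B [oB bB]] := pd_base mP.
have small := graph_box_small bB.
split.
- exists (graph_dist : Xt -> Xt -> R).
  split; [exact: gd_refl|exact: gd_eq|exact: gd_sym|exact: gd_tri|exact: tP| |].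
    move=> u cu.
    have [|l ul] := pd_complete mP (u := u).
      move=> e e0; have [N Nu] := cu e e0; exists N => i j Ni Nj.
      by apply: le_lt_trans (m_le _ _) _; exact: Nu.
    have /choice[c cP] k : exists c : R, H k (u n) @[n --> \oo] --> c.
      apply: real_cauchy_cvg => e e0.
      (* Below the truncation level of coordinate [k], the distance bounds the true difference of
         [H k]. *)
      have e0' : 0 < Num.min e k.+1%:R^-1 by rewrite lt_min e0 k0.
      have [N Nu] := cu _ e0'; exists N => i j Ni Nj.
      have := graph_dist_lt (_ : _ <= k.+1%:R^-1) (Nu i j Ni Nj).
      by rewrite ge_min lexx orbT => /(_ isT); rewrite lt_min => /andP[].
    exists l => e e0; have e2 : 0 < e / 2 by lra.
    have [K /= _ /(_ K (leqnn K)) Ke] := near_infty_natSinv_lt (PosNum e2).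
    have hK : \forall n \near \oo, forall k, (k < K)%N -> `|H k l - H k (u n)| < e / 2.
      apply: near_lt_forall => k.
      have /cvgrPdist_lt/(_ _ e2) := cP k.
      (* The closed graph identifies the limits of the coordinates with the coordinates of the limit
         point. *)
      by rewrite (cH u l c) //; apply/(pd_cvg mP).
    near=> n; suff : graph_dist l (u n) <= e / 2 by lra.
    apply: graph_dist_le; first by apply: ltW; near: n; exact: ul.
    move=> k; rewrite /tr ge_min; apply/orP; have [kK|Kk] := ltnP k K.
      by right; apply: ltW; move: k kK; near: n.
    left; apply: le_trans (ltW Ke); rewrite lef_pV2 ?posrE ?ltr0Sn// ler_nat.
    by rewrite ltnS.
  (* A dense sequence: one point from every non-empty rational box. *)
  exists (fun n => if unpickle n is Some c then
    (if pselect (exists x, graph_box B c x) is left h then Some (projT1 (cid h)) else None)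
    else None).
  move=> x e e0; have [c cx ce] := small x e e0.
  exists (pickle c); rewrite pickleK; case: pselect => [h|[]]; last by exists x.
  by case: cid => y /= cy; exists y; split=> //; exact: ce.
- move=> U oU; apply/tP => x Ux; have [r r0 rU] := (pd_open mP U).1 oU x Ux.
  by exists r => // y xy; apply: rU; exact: le_lt_trans (m_le _ _) xy.
- by move=> U /tP; exact: (graph_open_Sigma0 xi1 mH).
- move=> k O oO; apply/tP => x /= Ox.
  have : nbhs (H k x) O by exact: open_nbhs_nbhs.
  move=> /nbhs_ballP[e /= e0 eO].
  exists (Num.min e k.+1%:R^-1); first by rewrite lt_min e0 k0.
  move=> y xy; apply: eO; rewrite /ball /=.
  have := graph_dist_lt (_ : _ <= k.+1%:R^-1) xy.
  by rewrite ge_min lexx orbT => /(_ isT); rewrite lt_min => /andP[].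
Unshelve. all: by end_near. Qed.

End RefinedMetric.


(* [H] codes a refinement of the topology in which [S] is open, and [N] is the
   one further coordinate to be added in order to make [S] clopen. *)
Definition open_code xi S H N := [/\ closed_graph H,
  forall (u : nat -> X) (x : X) (c : R), u n @[n --> \oo] --> x ->
    (forall k, H k (u n) @[n --> \oo] --> H k x) ->
    N (u n) @[n --> \oo] --> c -> c = N x,
  forall k O, open O -> Sigma0 xi (H k @^-1` O),
  forall z O, (xi < z)%O -> open O -> Sigma0 z (N @^-1` O) &
  [/\ forall x, S x -> 1 <= N x, forall x, ~ S x -> N x = 0 &
    open S \/ forall x, S x -> exists2 k, H k x < 1 & forall y, H k y < 1 -> S y]].

Lemma cvg_eq (a : nat -> R) (b c : R) :
  a n @[n --> \oo] --> b -> a n @[n --> \oo] --> c -> b = c.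
Proof. by move=> ab ac; apply: (@cvg_unique R (@Rhausdorff R) _ _ _ _ ab ac). Qed.

Lemma closed_graph_cst : closed_graph (fun=> fun=> 0).
Proof. by move=> u x c _ h k; apply/esym; apply: (cvg_eq _ (h k)); exact: cvg_cst. Qed.

Lemma Sigma0_preimage_cst xi (r : R) O : (oone <= xi)%O ->
  Sigma0 xi ((fun=> r) @^-1` O : set X).
Proof.
move=> xi1; have [Or|nOr] := pselect (O r).
  rewrite (_ : _ @^-1` O = setT); last by rewrite -subTset.
  by apply: (Sigma0_openS mP xi1); exact: openT.
rewrite (_ : _ @^-1` O = set0); last by rewrite -subset0.
by apply: (Sigma0_openS mP xi1); exact: open0.
Qed.

(** [N] is the reciprocal of the cozero function on [S]: it blows up at the boundary, so its graph
    is closed, and it jumps from 0 to at least 1 between the complement and [S]. *)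
Lemma open_code_open S : open S -> exists H N, open_code oone S H N.
Proof.
move=> oS; have [v [cv v01 Sv]] := open_cozero mP oS.
pose N x := if pselect (S x) then (v x)^-1 else 0.
have v0 x : ~ S x -> v x = 0.
  move=> nSx; apply/eqP; rewrite eq_le; have /andP[-> _] := v01 x.
  by rewrite leNgt andbT; apply/negP => /Sv.
have N1 x : S x -> 1 <= N x.
  move=> Sx; rewrite /N; case: pselect => // ?.
  by rewrite invf_ge1; [case/andP: (v01 x)|exact/Sv].
have N0 x : ~ S x -> N x = 0 by rewrite /N; case: pselect.
(* An algebraic identity with the continuous [v] passes to limits: a limit [c] of values of [N] is
   either 0 or the reciprocal of [v x]. *)
have NvN x : N x * (N x * v x) = N x.
  rewrite /N; case: pselect => [Sx|?] /=; last by rewrite mul0r.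
  by rewrite mulVf ?mulr1// gt_eqF//; exact/Sv.
exists (fun=> fun=> 0), N; split.
- exact: closed_graph_cst.
- move=> u x c ux _ Nc.
  have vx : v (u n) @[n --> \oo] --> v x by apply: cvg_comp ux (cv x).
  have E : c * (c * v x) = c.
    apply: (cvg_eq _ Nc); under eq_fun do rewrite -NvN.
    by apply: cvgM => //; exact: cvgM.
  have [Sx|nSx] := pselect (S x); last by rewrite N0// -E v0// !mulr0.
  have c1 : 1 <= c.
    suff : [set t : R | 1 <= t] c by [].
    apply: (@closed_cvg _ _ \oo _ (N \o u)) Nc; first exact: closed_ge.
    have Su : \forall n \near \oo, S (u n) by apply: (ux S); exact: open_nbhs_nbhs.
    by apply: filterS Su => n /N1.
  have cn0 : c != 0 by rewrite gt_eqF//; lra.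
  have vc : v x = c^-1.
    apply: (mulfI cn0); rewrite mulfV//; apply: (mulfI cn0); by rewrite E mulr1.
  by rewrite /N; case: pselect => // ?; rewrite vc invrK.
- by move=> k O _; exact: Sigma0_preimage_cst.
- move=> z O xz oO; have z1 : (oone <= z)%O := ltW xz.
  have -> : N @^-1` O = [set x | S x /\ O (v x)^-1] `|` (~` S `&` ((fun=> 0) @^-1` O)).
    apply/seteqP; split=> x /=; rewrite /N; case: pselect => // Sx.
    + by move=> Ox; left.
    + by move=> Ox; right.
    + by move=> [[]|[]].
    + by move=> [[]|[]].
  apply: Sigma0U.
    apply: (Sigma0_openS mP z1); rewrite openE => x [Sx Ox].
    have c1 : (v y)^-1 @[y --> x] --> (v x)^-1.
      by apply: cvgV; [rewrite gt_eqF//; exact/Sv|exact: cv].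
    have := c1 O (open_nbhs_nbhs (conj oO Ox)).
    have : nbhs x S by exact: open_nbhs_nbhs.
    by apply: filterS2 => y Sy Oy; split.
  apply: (Sigma0I mP); last exact: Sigma0_preimage_cst.
  by apply: (Sigma0_compl xz); exact: Sigma0_open.
- by split=> //; left.
Qed.

(** Since [eta n < xi], the coordinate [Ns n] has class [xi] and may join [H]. This makes every
    [A n] clopen and hence the union open. Making the union clopen takes one more coordinate, the
    index of the first [A n] containing the point, whose class is only above [xi]. *)
Lemma open_code_bigcup xi (eta : nat -> W) (A : nat -> set X) :
  (forall n, (oone <= eta n)%O) -> (forall n, (eta n < xi)%O) ->
  (forall n, Sigma0 (eta n) (~` A n)) ->
  (forall n, exists H N, open_code (eta n) (~` A n) H N) ->
  exists H N, open_code xi (\bigcup_n A n) H N.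
Proof.
move=> e1 exi sA /choice[Hs /choice[Ns HN]].
have xi1 : (oone <= xi)%O by apply: le_trans (e1 0%N) (ltW (exi 0%N)).
have N1 n x : ~ A n x -> 1 <= Ns n x by have [_ _ _ _ [h _ _]] := HN n; exact: h.
have N0 n x : A n x -> Ns n x = 0.
  by have [_ _ _ _ [_ h _]] := HN n => Ax; apply: h => /(_ Ax).
(* Row [n] holds [Ns n] in slot 0 and [Hs n k] in slot [k.+1]. *)
pose H p := if (nat_pair p).2 is k.+1 then Hs (nat_pair p).1 k else Ns (nat_pair p).1.
have HE n k : H (pickle (n, k.+1)) = Hs n k by rewrite /H nat_pairK.
have HE0 n : H (pickle (n, 0%N)) = Ns n by rewrite /H nat_pairK.
(* The first index is shifted by one; the value 0 is reserved for points outside the union. *)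
have /choice[N' NP] x : exists j : nat, (j = 0%N /\ forall n, ~ A n x) \/
    (exists n, [/\ j = n.+1, A n x & forall k, (k < n)%N -> ~ A k x]).
  have [h|nh] := pselect (exists n, `[< A n x >]); last first.
    by exists 0%N; left; split=> // n Anx; apply: nh; exists n; exact/asboolP.
  case: (ex_minnP h) => n /asboolP An nmin; exists n.+1; right; exists n; split=> //.
  by move=> k kn /asboolP /nmin; rewrite leqNgt kn.
pose N x := (N' x)%:R : R.
exists H, N; split.
- move=> u x c ux Hc.
  (* The closed graph of [Hs n] comes first: it supplies the convergence under which the graph
     condition for [Ns n] applies. *)
  have cHs n k : Hs n k (u i) @[i --> \oo] --> Hs n k x.
    have [cg _ _ _ _] := HN n.
    rewrite -(cg u x (fun k => c (pickle (n, k.+1))) ux); first by rewrite -HE; exact: Hc.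
    by move=> k'; rewrite -HE; exact: Hc.
  move=> p; have := Hc p; rewrite /H; case: (nat_pair p) => n [|k] /= Hp.
    by have [_ dt _ _ _] := HN n; exact: (dt u x _ ux (cHs n)).
  exact: (cvg_eq Hp (cHs n k)).
- move=> u x c ux Hc /nat_cvg_stationary[j -> uj]; congr (_%:R).
  have cN n : Ns n (u i) @[i --> \oo] --> Ns n x by rewrite -HE0; exact: Hc.
  (* Half of the gap between the value 0 of [Ns n] on [A n] and its values, at least 1, off
     [A n]. *)
  have h2 : 0 < 2^-1 :> R by rewrite invr_gt0.
  have trA n : (\forall i \near \oo, A n (u i)) -> A n x.
    move=> Au; apply: contrapT => /N1 Nx.
    have /cvgrPdist_lt/(_ _ h2) cl := cN n.
    have [i [Ai]] : exists i, A n (u i) /\ `|Ns n x - Ns n (u i)| < 2^-1.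
      by apply: (@filter_ex _ \oo); exact: filterI.
    by rewrite (N0 _ _ Ai) subr0 => /(le_lt_trans (ler_norm _)); lra.
  have trN n : (\forall i \near \oo, ~ A n (u i)) -> ~ A n x.
    move=> Au /N0 Nx.
    have /cvgrPdist_lt/(_ _ h2) cl := cN n.
    have [i [/N1 Ni]] : exists i, ~ A n (u i) /\ `|Ns n x - Ns n (u i)| < 2^-1.
      by apply: (@filter_ex _ \oo); exact: filterI.
    by rewrite Nx sub0r normrN => /(le_lt_trans (ler_norm _)); lra.
  have st y : N' y = 0%N -> forall n, ~ A n y by case: (NP y) => [[]//|[n [-> _]]].
  have sS y n : N' y = n.+1 -> A n y /\ forall k, (k < n)%N -> ~ A k y.
    by case: (NP y) => [[->]//|[k [-> ? ?] [<-]]].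
  case: j uj => [|n] uj.
    have nA n : ~ A n x by apply: trN; apply: filterS uj => i /st.
    by case: (NP x) => [[->]//|[n [_ /nA]]].
  have An : A n x by apply: trA; apply: filterS uj => i /sS[].
  have nA k : (k < n)%N -> ~ A k x.
    by move=> kn; apply: trN; apply: filterS uj => i /sS[_]; exact.
  case: (NP x) => [[_ /(_ n)]//|[k [-> Ak kmin]]]; congr _.+1.
  by have [/nA|/kmin|] := ltngtP k n.
- move=> p O oO; rewrite /H; case: (nat_pair p) => n [|k] /=.
    by have [_ _ _ h _] := HN n; exact: h.
  by have [_ _ h _ _] := HN n; apply: (Sigma0_le mP (ltW (exi n))); exact: h.
- move=> z O xz oO; have z1 := le_trans xi1 (ltW xz).
  have -> : N @^-1` O = \bigcup_j ([set x | N' x = j] `&` (fun=> j%:R) @^-1` O).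
    apply/seteqP; split=> x /=; first by move=> Ox; exists (N' x).
    by move=> [j _ [/= <-]].
  apply: Sigma0_bigcupS => j.
  apply: (Sigma0I mP); last exact: Sigma0_preimage_cst.
  case: j => [|n].
    have -> : [set x | N' x = 0%N] = ~` \bigcup_n A n.
      apply/seteqP; split=> x /=; case: (NP x) => [[-> nA]//|[n [-> An _]]//].
      by move=> _ [n _ /nA].
      by move=> []; exists n.
    by apply: (Sigma0_compl xz); apply: (Sigma0_bigcup e1).
  have -> : [set x | N' x = n.+1] = A n `&` [set x | forall k, (k < n)%N -> (~` A k) x].
    apply/seteqP; split=> x /=; case: (NP x) => [[-> nA]//|[k [-> Ak kmin]]].
    - by move=> [<-].
    - by move=> [/nA].
    - by move=> [An nAk]; congr _.+1; have [/nAk|/kmin|] := ltngtP k n.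
  apply: (Sigma0I mP).
    by rewrite -[A n]setCK; apply: Sigma0_compl (sA n); exact: lt_trans xz.
  apply: Sigma0_lt_forall => // k; apply: (Sigma0_le mP) (sA k).
  exact: ltW (lt_trans (exi k) xz).
- split.
  + move=> x [n _ An]; rewrite /N; case: (NP x) => [[_ /(_ n)]//|[k [-> _ _]]].
    by rewrite ler1n.
  + move=> x nA; rewrite /N; case: (NP x) => [[-> _]//|[k [_ Ak _]]].
    by case: nA; exists k.
  + right=> x [n _ An]; exists (pickle (n, 0%N)); rewrite HE0; first by rewrite N0.
    move=> y Ny; exists n => //; apply: contrapT => /N1; lra.
Qed.

Lemma open_code_ex xi S : Sigma0 xi S -> exists H N, open_code xi S H N.
Proof.
elim=> [{}S oS|{}xi eta A e1 exi sA IH]; first exact: open_code_open.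
exact: open_code_bigcup exi sA IH.
Qed.

(** Only the [H] parts of the codes are adjoined. The sets have to become open, not clopen, and
    leaving out the [N] parts keeps the new open sets in class [xi]. *)
Lemma polish_refinement xi (V : nat -> set X) : (oone <= xi)%O ->
  (forall k, V k = set0 \/ Sigma0 xi (V k)) ->
  exists t : Topological X, let Xt : topologicalType := Topological.Pack t in
    [/\ exists mt : Xt -> Xt -> R, polish_dist mt, @open X `<=` @open Xt,
      @open Xt `<=` @Sigma0 d W X xi & forall k, @open Xt (V k)].
Proof.
move=> xi1 sV.
have /choice[Hs HsP] k : exists H, [/\ closed_graph H,
    forall j O, open O -> Sigma0 xi (H j @^-1` O) &
    open (V k) \/ forall x, V k x -> exists2 j, H j x < 1 & forall y, H j y < 1 -> V k y].
  have [E|/open_code_ex[H [N [? _ ? _ [_ _ ?]]]]] := sV k; last by exists H.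
  exists (fun=> fun=> 0); split.
  - exact: closed_graph_cst.
  - by move=> j O _; exact: Sigma0_preimage_cst.
  - by left; rewrite E; exact: open0.
pose H p := Hs (nat_pair p).1 (nat_pair p).2.
have [||t [tp t1 t2 t3]] := @refinement_of_graph H xi xi1.
- move=> u x c ux Hc p; have [cg _ _] := HsP (nat_pair p).1.
  rewrite /H -(cg u x (fun k => c (pickle ((nat_pair p).1, k))) ux).
    apply: (cvg_eq (Hc p)).
    by have := Hc (pickle ((nat_pair p).1, (nat_pair p).2)); rewrite /H nat_pairK.
  by move=> k; have := Hc (pickle ((nat_pair p).1, k)); rewrite /H nat_pairK.
- by move=> p O oO; have [_ h _] := HsP (nat_pair p).1; exact: h.
exists t; split=> // k; have [_ _ [/t1//|Vx]] := HsP k.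
have -> : V k = \bigcup_(j in [set j | Hs k j @^-1` [set r | r < 1] `<=` V k])
    Hs k j @^-1` [set r | r < 1].
  apply/seteqP; split=> [x /Vx[j jx jV]|x [j jV jx]]; last exact: jV.
  by exists j.
apply: bigcup_open => j _.
have := t3 (pickle (k, j)) [set r | r < 1] (@open_lt R 1).
by rewrite /H nat_pairK.
Qed.

End Refinement.

(** * Cantor sets and universal sets *)

Section CantorScheme.
Context {d : Order.disp_t} {W : omega1Type d} {R : realType} {X : topologicalType}.
Context {m : X -> X -> R}.
Hypothesis mP : polish_dist m.

Definition agree (K : nat) (z z' : nat -> bool) := forall k, (k < K)%N -> z' k = z k.

Definition cylinder_open (D : set (nat -> bool)) :=
  forall z, D z -> exists K, forall z', agree K z z' -> D z'.

Definition cantor_embedding (phi : (nat -> bool) -> X) :=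
  injective phi /\ forall U, open U -> cylinder_open (phi @^-1` U).

Lemma pd_hausdorff : hausdorff_space X.
Proof.
move=> x y xy; apply: contrapT => nxy.
have r0 : 0 < m x y / 2.
  rewrite divr_gt0// lt_neqAle (pd_ge0 mP) andbT; apply/eqP => /esym.
  by move=> /(pd_eq mP).
have bl z : nbhs z [set t | m z t < m x y / 2] by apply/(pd_nbhs mP); exists (m x y / 2).
have [z [/= xz yz]] := xy _ _ (bl x) (bl y).
by have := pd_tri mP z x y; rewrite (pd_sym mP z y); lra.
Qed.

Lemma cylinder_nbhs (z : cantor_space) K : nbhs z (agree K z).
Proof.
elim: K => [|K IH]; first by apply: filterS filterT => z' _ k.
have zK : nbhs z [set z' : cantor_space | z' K = z K].
  have := @proj_continuous nat (fun=> bool) K z.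
  by move=> /(_ [set z K]); apply; exact: discrete_set1.
apply: filterS2 IH zK => z' h zK k; rewrite ltnS leq_eqVlt => /orP[/eqP ->//|].
exact: h.
Qed.

(** The complement of this set is the image of the compact set of sequences outside [D], hence
    closed. *)
Lemma cantor_embedding_open phi D : cantor_embedding phi -> cylinder_open D ->
  open (~` range phi `|` phi @` D).
Proof.
move=> [phii phic] oD.
have -> : ~` range phi `|` phi @` D = ~` (phi @` (~` D)).
  apply/seteqP; split=> x /=.
    move=> [nx|[z Dz <-]] [z' nDz']; first by move=> zx; apply: nx; exists z'.
    by move=> /phii E; apply: nDz'; rewrite E.
  move=> nx; have [[z _ zx]|] := pselect (range phi x); last by left.
  right; exists z => //; apply: contrapT => nDz; apply: nx; by exists z.
apply: closed_openC; apply: (compact_closed pd_hausdorff).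
have cphi : continuous (phi : cantor_space -> X).
  move=> z A; rewrite nbhsE => -[U [oU Uz] UA].
  have [K zK] := phic U oU z Uz.
  by apply: filterS (cylinder_nbhs z K) => z' /zK/UA.
apply: (@continuous_compact cantor_space X phi (~` D)).
  exact: continuous_subspaceT.
apply: (@subclosed_compact cantor_space _ setT _ cantor_space_compact) => //.
apply: open_closedC; rewrite openE => z /oD[K zK].
by apply: filterS (cylinder_nbhs z K) => z' /zK.
Qed.

Lemma perfect_cantor (P : set X) : perfect_set P -> P !=set0 ->
  exists2 phi, cantor_embedding phi & range phi `<=` P.
Proof.
move=> [cP lP] [x0 Px0].
pose good (p : X * R) := P p.1 /\ 0 < p.2.
pose inside (p : X * R) z := m p.1 z <= p.2.
pose next (k : nat) (p q : X * R) :=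
  [/\ good q, forall z, inside q z -> inside p z & q.2 < k.+1%:R^-1].
have /choice[sp spP] kp : exists q : (X * R) * (X * R), good kp.2 ->
    [/\ next kp.1 kp.2 q.1, next kp.1 kp.2 q.2 & forall z, inside q.1 z -> inside q.2 z -> False].
  have [gp|] := pselect (good kp.2); last by move=> ?; exists (kp.2, kp.2).
  case: kp gp => k [x r] [/= Px r0].
  have : limit_point P x by rewrite lP.
  have r2 : 0 < r / 2 by lra.
  move=> /(_ [set y | m x y < r / 2]) [|y [yx Py /= xy]].
    by apply/(pd_nbhs mP); exists (r / 2).
  have D0 : 0 < m x y.
    rewrite lt_neqAle (pd_ge0 mP) andbT; apply: contraNneq yx => E.
    by apply/eqP; rewrite (pd_eq mP (esym E)).
  (* A third of the distance separates the two balls; [r / 4] keeps both inside the old one, the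
     second center being within [r / 2] of the first. *)
  pose r' := Num.min (m x y / 3) (Num.min (r / 4) (k.+1%:R^-1 / 2)).
  have k0 : 0 < k.+1%:R^-1 :> R by rewrite invr_gt0.
  have r'0 : 0 < r' by rewrite !lt_min !divr_gt0.
  have [r1 rr2 r3] : [/\ r' <= m x y / 3, r' <= r / 4 & r' <= k.+1%:R^-1 / 2].
    by rewrite /r' !ge_min !lexx !orbT.
  have rk : r' < k.+1%:R^-1 by move: k0 r3; set c := _^-1; lra.
  exists ((x, r'), (y, r')) => _; split.
  - by split=> // z; rewrite /inside /=; lra.
  - by split=> // z; rewrite /inside /=; have := pd_tri mP y x z; lra.
  - by rewrite /inside /= => z; have := pd_tri mP z x y; rewrite (pd_sym mP z y); lra.
pose p (z : nat -> bool) := fix p k := if k is k'.+1 then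
  (if z k' then (sp (k', p k')).2 else (sp (k', p k')).1) else (x0, 1).
have gp z k : good (p z k).
  elim: k => [|k IH]; first by split=> //; exact: ltr01.
  by have [[? _ _] [? _ _] _] := spP (k, p z k) IH; rewrite /=; case: (z k).
have np z k : next k (p z k) (p z k.+1).
  by have [? ? _] := spP (k, p z k) (gp z k); rewrite /=; case: (z k).
have /choice[phi phiP] z : exists l, forall k, inside (p z k) l.
  have [||k|l lin _] := @pd_nested _ _ _ mP (fun k => (p z k).1) (fun k => (p z k).2).
  - by move=> k y; have [_ h _] := np z k; exact: h.
  - move=> t t0; have [k /= _ /(_ k (leqnn k)) kt] := near_infty_natSinv_lt (PosNum t0).
    by exists k.+1; have [_ _ h] := np z k; exact: lt_trans kt.
  - by have [_ /ltW] := gp z k.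
  - by exists l.
have p_agree z z' k : agree k z z' -> p z' k = p z k.
  elim: k => //= k IH zz; rewrite IH; first by rewrite zz.
  by move=> j jk; apply: zz; exact: ltnW.
have small z e : 0 < e -> exists k, (p z k).2 < e.
  move=> e0; have [k /= _ /(_ k (leqnn k)) kt] := near_infty_natSinv_lt (PosNum e0).
  by exists k.+1; have [_ _ h] := np z k; exact: lt_trans kt.
exists phi.
  split.
    move=> z z' E; apply: contrapT => nz.
    have exk : exists k, z' k != z k.
      apply: contrapT => h; apply: nz; apply/funext => k; apply: contrapT => nk.
      by apply: h; exists k; apply/eqP => /esym.
    case: (ex_minnP exk) => k nk kmin.
    have ag : agree k z z'.
      by move=> j jk; apply: contrapT => /eqP /kmin; rewrite leqNgt jk.
    have [_ _ dj] := spP (k, p z k) (gp z k).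
    have := phiP z k.+1; have := phiP z' k.+1; rewrite -E /= (p_agree _ _ _ ag).
    by move: nk; case: (z k); case: (z' k) => // _ h1 h2; apply: (dj (phi z)).
  move=> U /(pd_open mP) oU z /oU[r r0 rU].
  have r2 : 0 < r / 2 by lra.
  have [k kr] := small z _ r2; exists k => z' ag; apply: rU.
  have := phiP z k; have := phiP z' k; rewrite (p_agree _ _ _ ag) /inside.
  by have := pd_tri mP (p z k).1 (phi z) (phi z'); rewrite (pd_sym mP (phi z) (p z k).1); lra.
move=> _ [z _ <-]; apply: cP; apply/(pd_closure mP) => e e0.
have [k ke] := small z e e0; exists (p z k).1; first by have [] := gp z k.
by rewrite (pd_sym mP); apply: le_lt_trans ke; exact: phiP.
Qed.

(** [P] is the set of condensation points; its complement is covered by the countable members of a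
    countable base. A neighbourhood of a point of [P] with no other point of [P] would be
    countable. *)
Lemma uncountable_perfect : ~ countable [set: X] ->
  exists2 P : set X, P !=set0 & perfect_set P.
Proof.
move=> uX; have [B [oB bB]] := pd_base mP.
pose P : set X := [set x | forall U, open U -> U x -> ~ countable U].
have cnP : countable (~` P).
  apply: (@sub_countable _ _ _ (\bigcup_(n in [set n | countable (B n)]) B n)).
    apply: subset_card_le => x /= /existsNP[U /not_implyP[oU /not_implyP[Ux /contrapT cU]]].
    have [n [nx nU]] := bB x U oU Ux; exists n => //=.
    exact: sub_countable (subset_card_le nU) cU.
  by apply: bigcup_countable => // n.
exists P.
  apply: contrapT => P0; apply: uX.
  apply: sub_countable cnP; apply: subset_card_le => x _ /= Px.
  by apply: P0; exists x.
have cP : closed P.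
  move=> x clx U oU Ux cU.
  have [y [Py Uy]] := clx U (open_nbhs_nbhs (conj oU Ux)).
  exact: Py U oU Uy cU.
split=> //; apply/seteqP; split=> x.
  by move=> lx; apply: cP => U /lx[y [_ Py Uy]]; exists y.
move=> Px U; rewrite nbhsE => -[V [oV Vx] VU].
apply: contrapT => nV; apply: (Px V oV Vx).
apply: (@sub_countable _ _ _ ([set x] `|` ~` P)).
  apply: subset_card_le => y Vy; have [->|yx] := pselect (y = x); first by left.
  right=> Py; apply: nV; exists y; split=> //; [exact/eqP|exact: VU].
by apply: countableU => //; exact: countable1.
Qed.

(** The class is claimed only for the diagonal with a reindexed code, [U (z \o rho) z]. This is all
    that the diagonalization needs, and it survives the induction because taking a column of a code
    is itself a reindexing. *)
Lemma universal_Sigma0 phi : cantor_embedding phi -> forall xi : W, (oone <= xi)%O ->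
  exists U : (nat -> bool) -> (nat -> bool) -> Prop,
    (forall S, Sigma0 xi S -> exists y, forall z, U y z <-> S (phi z)) /\
    (forall rho : nat -> nat,
       Sigma0 xi (~` range phi `|` phi @` [set z : nat -> bool | U (z \o rho) z])).
Proof.
move=> phiE; have [phii phic] := phiE.
elim/(well_founded_ind (@omega1_wf d W)) => xi IH xi1.
have oC : open (~` range phi).
  have := @cantor_embedding_open phi set0 phiE; rewrite image_set0 setU0; apply.
  by move=> z.
move: xi1; rewrite le_eqVlt => /orP[/eqP E|xi1].
  pose cyl n (z : nat -> bool) := if unpickle n is Some s then
    forall k, (k < size s)%N -> z k = nth false s k else False.
  exists (fun y z => exists2 n, y n & cyl n z); split.
    move=> S; rewrite -E => /Sigma0_open_inv oS.
    exists (fun n => `[< forall z, cyl n z -> S (phi z) >]) => z; split.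
      by move=> [n /asboolP nS nz]; exact: nS.
    move=> /(phic S oS)[K KS]; exists (pickle (mkseq z K)); rewrite /cyl pickleK.
      apply/asboolP => z' zz'; apply: KS => k kK.
      by rewrite zz' ?size_mkseq// nth_mkseq.
    by move=> k; rewrite size_mkseq => kK; rewrite nth_mkseq.
  move=> rho; rewrite -E; apply: Sigma0_open; apply: cantor_embedding_open => //.
  move=> z [n zn cz].
  (* Agreement through position [rho n] keeps [n] in the reindexed code; agreement along the word
     keeps the point in the cylinder. *)
  exists (maxn (rho n).+1 (if unpickle n is Some s then size (s : seq bool) else 0)) => z' zz'.
  exists n; first by rewrite /= zz' ?leq_max ?leqnn.
  move: cz zz'; rewrite /cyl; case: unpickle => // s cz zz' k ks.
  by rewrite -cz// zz'// leq_max ks orbT.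
have /countable_injP[f finj] := omega1_countable_lt xi.
(* Enumerates the classes from 1 up to but excluding [xi]; the default [oone] is such a class
   because [oone < xi]. *)
pose th a : W := xget oone [set b | [/\ (oone <= b)%O, (b < xi)%O & f b = a]].
have th1 a : (oone <= th a < xi)%O.
  by rewrite /th; case: xgetP => [b _ [-> ->]//|_]; rewrite lexx.
have ths b : (oone <= b)%O -> (b < xi)%O -> exists a, th a = b.
  move=> b1 bx; exists (f b); rewrite /th; case: xgetP => [c _ [_ cx fc]|/(_ b)[]//].
  by apply: finj fc; rewrite inE.
have /choice[Ut UtP] a : exists U : (nat -> bool) -> (nat -> bool) -> Prop,
    (forall S, Sigma0 (th a) S -> exists y, forall z, U y z <-> S (phi z)) /\
    (forall rho : nat -> nat,
       Sigma0 (th a) (~` range phi `|` phi @` [set z : nat -> bool | U (z \o rho) z])).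
  by have /andP[a1 ax] := th1 a; exact: IH.
pose a_ p := (nat_pair p).1.
exists (fun y z => exists p, ~ Ut (a_ p) (fun k => y (pickle (p, k))) z); split.
  move=> S /(Sigma0_normal xi1)[eta [A [e1 e2 sA ->]]].
  (* Each column has a class fixed in advance, so column [(a, n)] codes the complement of [A n] only
     if [eta n] is [th a]. Otherwise it codes the whole space, whose complement adds nothing to the
     union. *)
  have /choice[yp ypP] p : exists y, forall z,
      Ut (a_ p) y z <-> (eta (nat_pair p).2 = th (a_ p) -> ~ A (nat_pair p).2 (phi z)).
    have [h _] := UtP (a_ p).
    have [E|nE] := pselect (eta (nat_pair p).2 = th (a_ p)).
      have [|y yP] := h (~` A (nat_pair p).2); first by rewrite -E.
      by exists y => z; rewrite yP; split=> //; apply.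
    have [|y yP] := h setT.
      by apply: (Sigma0_openS mP); [case/andP: (th1 (a_ p))|exact: openT].
    by exists y => z; rewrite yP; split.
  exists (fun n => yp (nat_pair n).1 (nat_pair n).2) => z.
  have yE p : (fun k => yp (nat_pair (pickle (p, k))).1 (nat_pair (pickle (p, k))).2) = yp p.
    by apply/funext => k; rewrite nat_pairK.
  split=> [[p]|[n _ Anz]].
    rewrite yE ypP => /not_implyP[_ /contrapT Az].
    by exists (nat_pair p).2.
  have [a ta] := ths (eta n) (e1 n) (e2 n).
  exists (pickle (a, n)); rewrite yE ypP /a_ nat_pairK /= ta => h.
  exact: h.
move=> rho.
have -> : ~` range phi `|` phi @` [set z : nat -> bool |
    exists p, ~ Ut (a_ p) (fun k => (z \o rho) (pickle (p, k))) z] =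
    ~` range phi `|` \bigcup_p ~` (~` range phi `|`
      phi @` [set z : nat -> bool | Ut (a_ p) (z \o (fun k => rho (pickle (p, k)))) z]).
  apply/seteqP; split=> x; (case; first by left).
    move=> [z [p nU] <-]; right; exists p => // -[[]|[z' Uz' /phii E]]; first by exists z.
    by apply: nU; rewrite -E.
  move=> [p _ /not_orP[/contrapT[z _ <-] nU]]; right; exists z => //; exists p => Uz.
  by apply: nU; exists z.
apply: Sigma0U; first by apply: (Sigma0_openS mP) => //; exact: ltW.
apply: (Sigma0_bigcup (eta := fun p => th (a_ p))) => p.
- by case/andP: (th1 (a_ p)).
- by case/andP: (th1 (a_ p)).
- by rewrite setCK; have [_] := UtP (a_ p); apply.
Qed.

End CantorScheme.

(** * Diagonalization *)

Section Diagonal.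
Context {d : Order.disp_t} {W : omega1Type d} {R : realType} {X : topologicalType}.
Context {m : X -> X -> R}.
Hypothesis mP : polish_dist m.
Implicit Types (xi zeta eta : W).

Definition least_labelled (V : nat -> set X) (lab : pred nat) (prec : rel nat) : set X :=
  [set x | exists k, [/\ lab k, V k x & forall j, prec j k -> ~ V j x]].

(** If [y] codes the complements of all [F a] and [G a], then at [phi y] the conditions [V] say
    exactly which of these sets the point has left. The labels then contradict the prediction made
    from the first exit. *)
Lemma diagonal_difference phi xi zeta : cantor_embedding phi -> (oone <= xi)%O ->
  exists (V : nat -> set X) (lab : pred nat) (prec : rel nat),
  [/\ forall k, V k = set0 \/ Sigma0 xi (V k),
      forall j k, prec j k -> ~~ prec k j,
      forall x k, V k x -> exists2 k0, V k0 x & forall j, V j x -> j != k0 -> prec k0 j,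
      least_labelled V lab prec `<=` range phi &
      forall F G : W -> set X, F \bot%O = setT ->
        (forall eta, Sigma0 xi (~` F eta)) -> (forall eta, Sigma0 xi (~` G eta)) ->
        ~ (forall x, exists eta, [/\ (eta < zeta)%O,
             forall eta', (eta' < eta)%O -> F eta' x /\ G eta' x &
             (~ F eta x /\ ~ least_labelled V lab prec x) \/
             [/\ F eta x, ~ G eta x & least_labelled V lab prec x]])].
Proof.
move=> phiE xi1; have [phii _] := phiE.
have [U [Uu Um]] := universal_Sigma0 mP phiE xi1.
have /countable_injP[cd cdinj] := omega1_countable_lt zeta.
pose dec n : option W :=
  if pselect (exists eta, (eta < zeta)%O /\ cd eta = n) is left h
  then Some (projT1 (cid h)) else None.
have dec_lt n a : dec n = Some a -> (a < zeta)%O /\ cd a = n.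
  by rewrite /dec; case: pselect => // h; case: cid => b /= bP [<-].
have dec_cd a : (a < zeta)%O -> dec (cd a) = Some a.
  move=> az; rewrite /dec; case: pselect => [h|[]]; last by exists a.
  case: cid => b /= [bz E]; congr Some; apply: cdinj => //; by rewrite inE.
have dec_inj n n' a : dec n = Some a -> dec n' = Some a -> n = n'.
  by move=> /dec_lt[_ <-] /dec_lt[_ <-].
pose even_ a := (cd a).*2.
pose odd_ a := (cd a).*2.+1.
have dec_even a : (a < zeta)%O -> dec (even_ a)./2 = Some a.
  by move=> az; rewrite /even_ doubleK dec_cd.
have dec_odd a : (a < zeta)%O -> dec (odd_ a)./2 = Some a.
  by move=> az; rewrite /odd_ /= uphalf_double dec_cd.
have oddE a : odd (even_ a) = false by rewrite /even_ odd_double.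
have oddO a : odd (odd_ a) by rewrite /odd_ /= odd_double.
(* Each ordinal [a] has an even slot for leaving [F a] and, right after it, an odd slot for leaving
   [G a]. *)
pose prec k j := if (dec k./2, dec j./2) is (Some a, Some b)
  then (a < b)%O || [&& a == b, ~~ odd k & odd j] else false.
(* Leaving some [F a] first now means membership, the reverse of the prediction. *)
pose lab k := ~~ odd k && (dec k./2 != Some \bot%O).
pose rho (k n : nat) := pickle (k, n).
(* No point leaves [F \bot], which is everything. The very first slot is therefore free to hold the
   complement of the range with label false, which confines the set to the range. *)
pose V k : set X := if dec k./2 is Some a then
  (if (a == \bot%O) && ~~ odd k then ~` range phi
   else ~` range phi `|` phi @` [set z : nat -> bool | U (z \o rho k) z]) else set0.
have oC : open (~` range phi).
  have := @cantor_embedding_open _ _ _ mP phi set0 phiE; rewrite image_set0 setU0; apply.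
  by move=> z.
have V_dec k x : V k x -> exists a, dec k./2 = Some a.
  by rewrite /V; case: (dec _) => // a _; exists a.
exists V, lab, prec; split.
- move=> k; rewrite /V; case: (dec _) => [a|]; last by left.
  by right; case: ifP => _; [exact: (Sigma0_openS mP)|exact: Um].
- move=> j k; rewrite /prec; case: (dec j./2) (dec k./2) => [a|] [b|] //.
  move=> /orP[ab|/and3P[/eqP -> /negbTE jo ko]].
    by rewrite negb_or -leNgt ltW//= gt_eqF.
  by rewrite ltxx eqxx /= ko.
- move=> x k Vk; have [a0 ka0] := V_dec _ _ Vk.
  (* The least ordinal among the satisfied conditions carries at most two of them; the even slot
     wins if it is satisfied. *)
  have [a [[k1 [k1a Vk1]] amin]] : exists a,
      least [set a | exists k, dec k./2 = Some a /\ V k x] a.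
    by apply: least_ex; exists a0, k.
  have amin' j b : V j x -> dec j./2 = Some b -> (a <= b)%O.
    by move=> Vj jb; apply: amin; exists j.
  have [az ca] := dec_lt _ _ k1a.
  have same j : dec j./2 = Some a -> j = even_ a \/ j = odd_ a.
    move=> ja; have E := dec_inj _ _ _ ja (dec_cd _ az).
    by rewrite /even_ /odd_ -E -[j in j = _]odd_double_half -[j in _ \/ j = _]odd_double_half;
       case: (odd j); [right|left].
  have [Ve|nVe] := pselect (V (even_ a) x).
    exists (even_ a) => // j Vj jk; have [b jb] := V_dec _ _ Vj.
    rewrite /prec dec_even// jb oddE /=.
    have := amin' j b Vj jb; rewrite le_eqVlt => /orP[/eqP E|->//].
    rewrite E eqxx /=; apply/orP; right; rewrite -E in jb.
    by have [jE|->//] := same _ jb; rewrite jE eqxx in jk.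
  exists (odd_ a) => [|j Vj jk].
    by have [E|E] := same _ k1a; [rewrite E in Vk1|rewrite -E].
  have [b jb] := V_dec _ _ Vj; rewrite /prec dec_odd// jb.
  have := amin' j b Vj jb; rewrite le_eqVlt => /orP[/eqP E|->//].
  rewrite -E in jb; have [jE|jE] := same _ jb; first by rewrite jE in Vj.
  by rewrite jE eqxx in jk.
- move=> x [k [/andP[ko k0] Vk kmin]]; apply: contrapT => nx.
  have [a ka] := V_dec _ _ Vk; rewrite ka in k0.
  have a0 : (\bot < a)%O by rewrite lt0x; apply: contraNneq k0 => ->.
  have z0 : (\bot < zeta)%O by apply: lt_trans a0 _; have [] := dec_lt _ _ ka.
  apply: (kmin (even_ \bot%O)); first by rewrite /prec dec_even// ka a0.
  by rewrite /V dec_even// eqxx oddE.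
move=> F G F0 sF sG.
have /choice[ys ysP] k : exists y, forall a, dec k./2 = Some a ->
    forall z, U y z <-> (if odd k then ~ G a (phi z) else ~ F a (phi z)).
  case: (dec _) => [a|]; last by exists (fun=> false).
  have [|y yP] := Uu (if odd k then ~` G a else ~` F a); first by case: ifP.
  by exists y => _ [<-] z; rewrite yP; case: ifP.
pose y n := ys (nat_pair n).1 (nat_pair n).2.
have yE k : y \o rho k = ys k by apply/funext => n; rewrite /y /rho /= nat_pairK.
have VE k a : dec k./2 = Some a ->
    V k (phi y) <-> (if odd k then ~ G a (phi y) else ~ F a (phi y)).
  move=> ka; rewrite /V ka; case: ifP => [/andP[/eqP -> /negbTE ->]|_].
    by rewrite F0; split=> [[]|[]]//; exists y.
  rewrite -(ysP k a ka y) -yE; split=> [[[]|[z Uz /phii <-//]]|Uy]; first by exists y.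
  by right; exists y.
(* If the first exit is from [F eta], the even slot of [eta] is the first satisfied one and puts the
   point into the set. If it is from [G eta], a labelled slot putting the point into the set would
   have to precede the odd slot of [eta], against the choice of [eta]. *)
move=> /(_ (phi y))[eta [ez below [[nF nA]|[Fx nG [k [/andP[ko k0] Vk kmin]]]]]].
  apply: nA; exists (even_ eta); split.
  - rewrite /lab oddE dec_even//=; apply/eqP => -[E]; apply: nF.
    by rewrite E F0.
  - by apply/(VE _ eta (dec_even _ ez)); rewrite oddE.
  - move=> j; rewrite /prec dec_even//; case E : (dec _) => [b|//].
    rewrite oddE !andbF orbF => be; have [Fb Gb] := below b be.
    by move=> /(VE _ b E); case: ifP.
have [b kb] := V_dec _ _ Vk.
move: Vk => /(VE _ b kb); rewrite (negbTE ko) => nFb.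
have [be|eb|E] := ltgtP b eta.
- by have [] := below b be.
- apply: (kmin (odd_ eta)); first by rewrite /prec dec_odd// kb eb.
  by apply/(VE _ eta (dec_odd _ ez)); rewrite oddO.
- by apply: nFb; rewrite E.
Qed.

(** Take the least [eta] at which [x] is not in both [F eta] and [G eta]. If [x] is in [F eta], it
    misses the closure of [F eta] minus [A], so it lies in [A]. Otherwise [eta] is a successor of
    some [b], and since [x] is in [F b] and [G b], it must miss the closure of [F b] within [A], so
    it is not in [A]. *)
Lemma der_sep_decomposition (A : set X) (c : W) (F := iter_der (der_sep (~` A) A))
    (G := fun eta => closure (F eta `&` ~` A)) : F c = set0 ->
  forall x, exists eta, [/\ (eta <= c)%O,
     forall eta', (eta' < eta)%O -> F eta' x /\ G eta' x &
     (~ F eta x /\ ~ A x) \/ [/\ F eta x, ~ G eta x & A x]].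
Proof.
move=> Fc x.
have [eta [neta etamin]] : exists eta, least [set eta | ~ (F eta x /\ G eta x)] eta.
  by apply: least_ex; exists c => -[]; rewrite Fc.
have below eta' : (eta' < eta)%O -> F eta' x /\ G eta' x.
  by move=> lt; apply: contrapT => /etamin; rewrite leNgt lt.
exists eta; split=> //; first by apply: etamin => -[]; rewrite Fc.
have [Fx|nFx] := pselect (F eta x).
  right; have nG : ~ G eta x by move=> Gx; exact: neta.
  split=> //; apply: contrapT => nA; apply: nG.
  exact: subset_closure.
left; split=> // Ax; apply: nFx.
have [[b E]|nb] := pselect (exists b, eta = osucc b).
  have [|Fb Gb] := below b; first by rewrite E; exact: lt_osucc.
  rewrite E /F iter_derS; split; first exact: Gb.
  exact: subset_closure.
rewrite /F iter_der_lim => [b /= be|b E]; first by have [] := below b be.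
by apply: nb; exists b.
Qed.

End Diagonal.

(** * From the bound on alpha to the three starred ranks *)

Lemma ratr_indic_sets (R : realType) (T : Type) (A : set T) :
  [set x | (\1_A x : R) <= ratr (0 : rat)] = ~` A /\
  [set x | (\1_A x : R) >= ratr (1 : rat)] = A.
Proof.
rewrite rmorph0 rmorph1; split; apply/seteqP; split=> x /=; rewrite indicE.
- by move=> h Ax; rewrite mem_set// in h; move: h; rewrite ler10.
- by move=> nAx; rewrite memNset.
- by case: (boolP (x \in A)) => [|_]; [rewrite inE|rewrite ler10].
- by move=> Ax; rewrite mem_set.
Qed.

(** A single refinement, where gamma is countable, shows that all three minima are attained; the
    bound on alpha passes to beta and gamma in every refinement. *)
Lemma ranks_of_alpha_ge (d : Order.disp_t) (W : omega1Type d) (R : realType)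
    (X : topologicalType) (f : X -> R) (xi zeta : W) :
  refinements f xi !=set0 ->
  (forall t a, refinements f xi t -> @alpha d W R (Topological.Pack t) f = Some a ->
     (zeta <= a)%O) ->
  [/\ countable_ge zeta (alpha_star xi f), countable_ge zeta (beta_star xi f) &
      countable_ge zeta (gamma_star xi f)].
Proof.
move=> [t ft] h.
have hb t' b : refinements f xi t' -> @beta d W R (Topological.Pack t') f = Some b ->
    (zeta <= b)%O.
  by move=> ft' /beta_alpha[a E ab]; apply: le_trans ab; exact: h E.
have [c gc] : exists c, @gamma d W R (Topological.Pack t) f = Some c.
  by case: ft => /polish_distP[mt mtP] _ _ bf; exact: gamma_countable mtP bf.
have [b bc _] := gamma_beta gc; have [a ab _] := beta_alpha bc.
split; apply: countable_ge_min.
- by exists a, t.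
- by move=> a' [t' ft' E]; exact: h E.
- by exists b, t.
- by move=> b' [t' ft' E]; exact: hb E.
- by exists c, t.
- move=> c' [t' ft' /gamma_beta[b' E bc']].
  by apply: le_trans bc'; exact: hb E.
Qed.

Lemma perfect_large_ranks (d : Order.disp_t) (W : omega1Type d) (R : realType)
    (X : topologicalType) (xi zeta : W) (P : set X) :
  polish R X -> (oone <= xi)%O -> P !=set0 -> perfect_set P ->
    exists A : set X,
      [/\ A `<=` P, baire_class xi (\1_A : X -> R),
          countable_ge zeta (alpha_star xi (\1_A : X -> R)),
          countable_ge zeta (beta_star xi (\1_A : X -> R)) &
          countable_ge zeta (gamma_star xi (\1_A : X -> R))].
Proof.
move=> /polish_distP[m mP] xi1 P0 pP.
have [phi phiE phiP] := perfect_cantor mP pP P0.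
have [V [lab [prec [sV asym lst AP diag]]]] := diagonal_difference mP zeta phiE xi1.
pose A := least_labelled V lab prec.
have bA : baire_class xi (\1_A : X -> R).
  by apply: (baire_difference mP) => //; exact: lt_le_trans lt0_oone xi1.
have [|t a [_ _ tS _] fa|] := @ranks_of_alpha_ge d W R X (\1_A : X -> R) xi zeta.
- have [t [tP Xt tS oV]] := polish_refinement mP xi1 sV.
  exists t; split=> //; first exact/polish_distP.
  (* The same difference lemma at class 1, the conditions being open in the refined topology. *)
  have [mt mtP] := tP; apply: (@baire_difference d W R (Topological.Pack t) mt mtP) => //.
    exact: lt0_oone.
  by move=> k; right; exact: Sigma0_open.
- rewrite leNgt; apply/negP => az.
  (* The thresholds 0 and 1 recover the complement of [A] and [A] itself. *)
  have := alpha_rk fa (ltr01 : (0 : rat) < 1).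
  have [-> ->] := ratr_indic_sets R A.
  move=> /der_sep_decomposition dec.
  pose F : W -> set X := @iter_der d W X (@der_sep (Topological.Pack t) (~` A) A).
  pose G eta : set X := @closure (Topological.Pack t) (F eta `&` ~` A).
  apply: (diag F G).
  + exact: iter_der0.
  + move=> eta; apply: tS; apply: closed_openC.
    exact: iter_der_sep_closed.
  + by move=> eta; apply: tS; apply: closed_openC; exact: closed_closure.
  + move=> x; have [eta [ea h1 h2]] := dec x; exists eta; split=> //.
    exact: le_lt_trans ea az.
- move=> h1 h2 h3; exists A; split=> //.
  exact: subset_trans AP phiP.
Qed.

Theorem theorem5p20 (R : realType) (d : Order.disp_t) (W : omega1Type d)
    (X : topologicalType) (xi : W) :
  polish R X -> ~ countable [set: X] -> (oone <= xi)%O ->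
  [/\ unbounded_in_omega1 (@alpha_star d W R X) xi,
      unbounded_in_omega1 (@beta_star d W R X) xi &
      unbounded_in_omega1 (@gamma_star d W R X) xi] /\
  forall (P : set X) (zeta : W), P !=set0 -> perfect_set P ->
    exists A : set X,
      [/\ A `<=` P, baire_class xi (\1_A : X -> R),
          countable_ge zeta (alpha_star xi (\1_A : X -> R)),
          countable_ge zeta (beta_star xi (\1_A : X -> R)) &
          countable_ge zeta (gamma_star xi (\1_A : X -> R))].
Proof.
move=> pX uX xi1; split; last by move=> P zeta; exact: perfect_large_ranks.
have /polish_distP[m mP] := pX; have [P P0 pP] := uncountable_perfect mP uX.
by split=> zeta; have [A [_ bA a b c]] := perfect_large_ranks zeta pX xi1 P0 pP;
  exists (\1_A).
Qed.
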